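(* Let $R$ be a unital associative ring and $M$ a left $R$-module. (i) If $M$ is a flat module, then $\mathrm{pd}_R M = \mathrm{PGF\text{-}dim}_R M$. (ii) If $M$ is a PGF-module, then $\mathrm{pd}_R M = \mathrm{fd}_R M$.
   Context: $R$ is a unital associative ring; modules are left $R$-modules; $\mathrm{pd}_R$ and $\mathrm{fd}_R$ denote projective and flat dimension, with values in $\mathbb{N}\cup\{\infty\}$. A PGF-module (projectively coresolved Gorenstein flat module) is a syzygy (i.e. a kernel of some differential) of an acyclic ($\mathbb{Z}$-indexed) complex $P_*$ of projective modules such that the complex $I \otimes_R P_*$ is acyclic for every injective right $R$-module $I$; $\mathtt{PGF}(R)$ is the class of PGF-modules. For a module $M$, $\mathrm{PGF\text{-}dim}_R M$ is the least non-negative integer $n$ for which there is an exact sequence $0 \to G_n \to \cdots \to G_0 \to M \to 0$ with all $G_i \in \mathtt{PGF}(R)$, and $\mathrm{PGF\text{-}dim}_R M = \infty$ if no such $n$ exists. *)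

(* Defs.v *)
From HB Require Import structures.
From mathcomp Require Import all_boot all_algebra.
From mathcomp Require Import boolp.
From mathcomp.multinomials Require Import freeg.

Set Implicit Arguments.
Unset Strict Implicit.
Unset Printing Implicit Defensive.

Import GRing.Theory.
Local Open Scope ring_scope.
Local Open Scope quotient_scope.

(* A right R-module is an lmodType over the converse ring R^c: for a right
   module A, [r *: a] reads "a . r". *)

(** ** Tensor product of a right module and a left module *)

Section Tensor.
Variables (R : pzRingType) (A : lmodType R^c) (B : lmodType R).

Definition tens_free := {freeg (A * B)%type / int}.

Inductive tens_relation : tens_free -> Prop :=
| TensDl a a' b :
    tens_relation (<<(a + a', b)>> - <<(a, b)>> - <<(a', b)>>)
| TensDr a b b' :
    tens_relation (<<(a, b + b')>> - <<(a, b)>> - <<(a, b')>>)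
| TensZ (r : R) a b :
    tens_relation (<<((r : R^c) *: a, b)>> - <<(a, r *: b)>>).

Inductive tens_span : tens_free -> Prop :=
| TensSpan0 : tens_span 0
| TensSpanR u : tens_relation u -> tens_span u
| TensSpanB u v : tens_span u -> tens_span v -> tens_span (u - v).

Definition tens_kernel : {pred tens_free} := fun u => `[< tens_span u >].

Fact tens_kernel_zmod_closed : zmod_closed tens_kernel.
Proof.
split=> [|u v]; first exact/asboolP/TensSpan0.
by move=> /asboolP su /asboolP sv; apply/asboolP/TensSpanB.
Qed.

HB.instance Definition _ :=
  GRing.isZmodClosed.Build tens_free tens_kernel tens_kernel_zmod_closed.

Definition tensor : zmodType := Quotient.quot tens_kernel.

Definition tens_pi (u : tens_free) : tensor := \pi_(Quotient.quot tens_kernel) u.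

Definition tens (a : A) (b : B) : tensor := tens_pi <<(a, b)>>.

Lemma tens_piB : {morph tens_pi : u v / u - v}.
Proof. by move=> u v; rewrite /tens_pi raddfB. Qed.

Lemma tens_pi_eq u v : tens_pi u = tens_pi v <-> tens_span (u - v).
Proof.
split=> [/eqmodP/asboolP //|suv].
exact/eqmodP/asboolP.
Qed.

Lemma tens_piK (x : tensor) : tens_pi (repr (x : Quotient.quot tens_kernel)) = x.
Proof. exact: reprK. Qed.

Lemma tens_piD : {morph tens_pi : u v / u + v}.
Proof. by move=> u v; rewrite /tens_pi raddfD. Qed.

Lemma tens_pi_eq0 u : tens_span u -> tens_pi u = 0.
Proof.
move=> su; rewrite -(subrr (tens_pi u)) -tens_piB subrr.
by apply/tens_pi_eq; rewrite subr0.
Qed.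

Lemma tensDl a a' b : tens (a + a') b = tens a b + tens a' b.
Proof.
rewrite /tens -tens_piD; apply/tens_pi_eq/TensSpanR.
by rewrite opprD addrA; exact: TensDl.
Qed.

Lemma tensDr a b b' : tens a (b + b') = tens a b + tens a b'.
Proof.
rewrite /tens -tens_piD; apply/tens_pi_eq/TensSpanR.
by rewrite opprD addrA; exact: TensDr.
Qed.

Lemma tensZ (r : R) a b : tens ((r : R^c) *: a) b = tens a (r *: b).
Proof. exact/tens_pi_eq/TensSpanR/TensZ. Qed.

End Tensor.

Arguments tens {R A B} a b.

Section TensorMap.
Variables (R : pzRingType) (A A' : lmodType R^c) (B B' : lmodType R).
Variables (f : {linear A -> A'}) (g : {linear B -> B'}).

Definition tens_free_map : tens_free A B -> tens_free A' B' :=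
  fglift (fun p => <<(f p.1, g p.2)>> : tens_free A' B').

(* The map f (x) g, defined on representatives; [tens_mapE], together with
   the additivity of [tens_map], shows that it is well defined. *)
Definition tens_map (x : tensor A B) : tensor A' B' :=
  tens_pi (tens_free_map (repr (x : Quotient.quot (@tens_kernel R A B)))).

Lemma tens_free_mapB : {morph tens_free_map : u v / u - v}.
Proof. exact: lift_is_additive. Qed.

Lemma tens_free_mapU a b : tens_free_map <<(a, b)>> = <<(f a, g b)>>.
Proof. by rewrite /tens_free_map liftU scale1r. Qed.

Lemma tens_free_map_span u : tens_span u -> tens_span (tens_free_map u).
Proof.
elim=> [|_ []|v w _ sv _ sw].
- rewrite -(subrr 0) tens_free_mapB subrr; exact: TensSpan0.
- move=> a a' b; rewrite !tens_free_mapB !tens_free_mapU linearD.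
  exact/TensSpanR/TensDl.
- move=> a b b'; rewrite !tens_free_mapB !tens_free_mapU linearD.
  exact/TensSpanR/TensDr.
- move=> r a b; rewrite !tens_free_mapB !tens_free_mapU !linearZ.
  exact/TensSpanR/TensZ.
- by rewrite tens_free_mapB; exact: TensSpanB.
Qed.

Lemma tens_map_pi u : tens_map (tens_pi u) = tens_pi (tens_free_map u).
Proof.
apply/tens_pi_eq; rewrite -tens_free_mapB; apply/tens_free_map_span/tens_pi_eq.
exact: tens_piK.
Qed.

Lemma tens_mapE a b : tens_map (tens a b) = tens (f a) (g b).
Proof. by rewrite /tens tens_map_pi tens_free_mapU. Qed.

Fact tens_map_is_zmod_morphism : zmod_morphism tens_map.
Proof.
move=> x y; rewrite -(tens_piK x) -(tens_piK y) -tens_piB !tens_map_pi.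
by rewrite tens_free_mapB tens_piB.
Qed.

HB.instance Definition _ :=
  GRing.isZmodMorphism.Build (tensor A B) (tensor A' B') tens_map
    tens_map_is_zmod_morphism.

End TensorMap.

(** ** Modules *)

Definition exact_at (U V W : zmodType) (f : U -> V) (g : V -> W) : Prop :=
  forall v : V, g v = 0 <-> exists u : U, f u = v.

Definition surj (U V : Type) (f : U -> V) : Prop := forall v, exists u, f u = v.

Definition projective (R : pzRingType) (P : lmodType R) : Prop :=
  forall (U V : lmodType R) (p : {linear U -> V}) (f : {linear P -> V}),
    surj p -> exists h : {linear P -> U}, forall x, p (h x) = f x.

Definition injective_module (R : pzRingType) (E : lmodType R) : Prop :=
  forall (U V : lmodType R) (i : {linear U -> V}) (f : {linear U -> E}),
    injective i -> exists h : {linear V -> E}, forall x, h (i x) = f x.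

Definition flat (R : pzRingType) (M : lmodType R) : Prop :=
  forall (A B : lmodType R^c) (i : {linear A -> B}),
    injective i -> injective (tens_map i (idfun : {linear M -> M})).

(** ** PGF-modules *)

Record chain_complex (R : pzRingType) := ChainComplex {
  cterm : int -> lmodType R;
  cdiff : forall i : int, {linear cterm (i + 1) -> cterm i};
  cdiffK : forall (i : int) x, cdiff i (cdiff (i + 1) x) = 0
}.

Definition acyclic (R : pzRingType) (P : chain_complex R) : Prop :=
  forall i : int, exact_at (cdiff P (i + 1)) (cdiff P i).

Definition tens_acyclic (R : pzRingType) (E : lmodType R^c) (P : chain_complex R) :
    Prop :=
  forall i : int, exact_at (tens_map (idfun : {linear E -> E}) (cdiff P (i + 1)))
                           (tens_map (idfun : {linear E -> E}) (cdiff P i)).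

(* M is identified with the kernel of [cdiff P i] through the embedding j. *)
Definition PGF (R : pzRingType) (M : lmodType R) : Prop :=
  exists P : chain_complex R,
    [/\ forall i, projective (cterm P i),
        acyclic P,
        forall E : lmodType R^c, injective_module E -> tens_acyclic E P
      & exists (i : int) (j : {linear M -> cterm P (i + 1)}),
          injective j /\ exact_at j (cdiff P i)].

(** ** Dimensions *)

(* An exact sequence 0 -> G_n -> ... -> G_0 -> M -> 0 with terms in C, extended
   by zero modules in degrees > n. *)
Definition has_resolution (R : pzRingType) (C : lmodType R -> Prop)
    (M : lmodType R) (n : nat) : Prop :=
  exists (G : nat -> lmodType R) (d : forall i, {linear G i.+1 -> G i})
         (e : {linear G 0 -> M}),
    [/\ forall i, (i <= n)%N -> C (G i),
        forall i, (n < i)%N -> forall x : G i, x = 0,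
        surj e,
        exact_at (d 0) e
      & forall i, exact_at (d i.+1) (d i)].

(* Values in N u {oo}, with [None] standing for oo. *)
Definition resolution_dim (R : pzRingType) (C : lmodType R -> Prop)
    (M : lmodType R) : option nat :=
  match pselect (exists n, `[< has_resolution C M n >]) with
  | left ex => Some (ex_minn ex)
  | right _ => None
  end.

Definition pd (R : pzRingType) (M : lmodType R) : option nat :=
  resolution_dim (@projective R) M.

Definition fd (R : pzRingType) (M : lmodType R) : option nat :=
  resolution_dim (@flat R) M.

Definition PGF_dim (R : pzRingType) (M : lmodType R) : option nat :=
  resolution_dim (@PGF R) M.

(* Main.v *)
Require Import Defs.
From HB Require Import structures.
From mathcomp Require Import all_boot all_algebra.
From mathcomp Require Import boolp classical_sets functions.
From mathcomp.multinomials Require Import freeg.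
Import Defs.

Set Implicit Arguments.
Unset Strict Implicit.
Unset Printing Implicit Defensive.

Import GRing.Theory Num.Theory.
Local Open Scope ring_scope.
Local Open Scope quotient_scope.

(* The key fact is that Hom(P, X) is acyclic when P is an acyclic complex of
   projectives such that E (x) P is acyclic for all injective E, and X is flat.
   The tensor condition, used for E = Hom_Z(R, D) with D a power of Q/Z, yields
   a finitary consequence: for every finite T in P_1 there is a finite T' in P_2
   such that any phi : P_1 -> X which vanishes on d(T') agrees on T with psi d
   for some psi : P_0 -> X. This property passes to the countable steps of a
   filtration of P by subcomplexes, where a global psi with psi d = phi is built
   by successive corrections; Zorn's lemma then glues the steps.

   By dimension shifting, Hom(P, X) is acyclic for X of finite flat dimension,
   so Ext^1(G, X) = 0 for every PGF-module G. Part (ii) follows: a PGF-module of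
   finite flat dimension is a direct summand of a flat module, then of a
   projective one. For part (i), lift the identity of a flat module M to maps
   between a PGF-resolution of length n and a projective resolution in both
   directions; the composite is homotopic to the identity and factors through a
   PGF-module in degree n, so the n-th syzygy of M is projective. *)

(** * Linear maps and submodules *)

Definition mklin (R : pzRingType) (U V : lmodType R) (f : U -> V)
    (Lf : linear f) : {linear U -> V} :=
  HB.pack f (GRing.isLinear.Build R U V *:%R f Lf).

Definition mkadd (U V : zmodType) (f : U -> V) (Bf : zmod_morphism f) :
    {additive U -> V} :=
  HB.pack f (GRing.isZmodMorphism.Build U V f Bf).

Section Submodule.
Variables (R : pzRingType) (U : lmodType R) (S : U -> Prop).
Hypotheses (S0 : S 0) (SZD : forall a x y, S x -> S y -> S (a *: x + y)).

Definition submod_pred : {pred U} := fun x => `[< S x >].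

Fact submod_pred_closed : subsemimod_closed submod_pred.
Proof.
split; first split; first exact/asboolP.
- move=> x y /asboolP Sx /asboolP Sy; apply/asboolP.
  by rewrite -(scale1r x); exact: SZD.
- move=> a x /asboolP Sx; apply/asboolP.
  by rewrite -[_ *: _]addr0; exact: SZD.
Qed.

Record submod_type :=
  SubmodType { submod_val : U; _ : submod_val \in submod_pred }.

HB.instance Definition _ := [isSub for submod_val].
HB.instance Definition _ := [Choice of submod_type by <:].
HB.instance Definition _ :=
  GRing.SubChoice_isSubLmodule.Build R U submod_pred submod_type
    submod_pred_closed.

(** Kernels, free modules and right ideals are all obtained from this embedding with prescribed
    image. *)
Lemma submodule_exists :
  exists (K : lmodType R) (j : {linear K -> U}),
    injective j /\ forall x, S x <-> exists k, j k = x.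
Proof.
exists submod_type, (val : {linear submod_type -> U}).
split; first exact: val_inj.
move=> x; split=> [Sx | [k <-]]; last exact/asboolP/(valP k).
have Sx' : x \in submod_pred by exact/asboolP.
by exists (SubmodType Sx').
Qed.

End Submodule.

Section LinearMaps.
Variable R : pzRingType.
Implicit Types U V W K : lmodType R.

Lemma kernel_exists U V (p : {linear U -> V}) :
  exists (K : lmodType R) (j : {linear K -> U}), injective j /\ exact_at j p.
Proof.
apply: (@submodule_exists R U (fun x => p x = 0)); first exact: raddf0.
by move=> a x y px py; rewrite linearP px py scaler0 addr0.
Qed.

Lemma corestrict U V W (j : {linear U -> V}) (f : {linear W -> V}) :
  injective j -> (forall w, exists u, j u = f w) ->
  exists g : {linear W -> U}, forall w, j (g w) = f w.
Proof.
move=> ij im; have [g gE] := choice im.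
have Lg : linear g by move=> a x y; apply: ij; rewrite linearP !gE linearP.
by exists (mklin Lg).
Qed.

Lemma quotient_factor U V W (p : {linear U -> V}) (f : {linear U -> W}) :
  surj p -> (forall x, p x = 0 -> f x = 0) ->
  exists g : {linear V -> W}, forall x, g (p x) = f x.
Proof.
move=> sp kf; have [s sE] := choice sp.
have pf x y : p x = p y -> f x = f y.
  move=> pxy; apply/eqP; rewrite -subr_eq0 -linearB; apply/eqP/kf.
  by rewrite linearB pxy subrr.
have Lg : linear (f \o s).
  by move=> a x y /=; rewrite -linearP; apply: pf; rewrite linearP !sE.
by exists (mklin Lg) => x /=; apply: pf; rewrite sE.
Qed.

Lemma bijective_inverse U V (f : {linear U -> V}) :
  injective f -> surj f ->
  exists g : {linear V -> U}, cancel f g /\ cancel g f.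
Proof.
move=> fi fs; have [g gE] := choice fs.
have Lg : linear g by move=> a x y; apply: fi; rewrite linearP !gE.
by exists (mklin Lg); split=> // x; apply: fi; exact: gE.
Qed.

End LinearMaps.

(** * Free and projective modules *)

Section LinearCombinations.
Variables (R : pzRingType) (K : choiceType).
Implicit Types (s : seq (R * K)) (X Y : lmodType R).

(** A list stands for an element of the free module on [K], and [lcomb psi] for the linear extension
    of [psi]. *)
Definition lcomb X (psi : K -> X) s : X := \sum_(p <- s) p.1 *: psi p.2.

Lemma lcomb_cat X (psi : K -> X) s1 s2 :
  lcomb psi (s1 ++ s2) = lcomb psi s1 + lcomb psi s2.
Proof. exact: big_cat. Qed.

Definition scale_lcomb (a : R) s := [seq (a * p.1, p.2) | p <- s].

Lemma lcomb_scale X (psi : K -> X) a s :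
  lcomb psi (scale_lcomb a s) = a *: lcomb psi s.
Proof.
rewrite /lcomb big_map scaler_sumr; apply: eq_bigr => p _.
by rewrite /= scalerA.
Qed.

Lemma eq_lcomb X (psi psi' : K -> X) s :
  {in [seq p.2 | p <- s], psi =1 psi'} -> lcomb psi s = lcomb psi' s.
Proof.
move=> eqpsi; rewrite /lcomb big_seq [RHS]big_seq.
by apply: eq_bigr => p ps; rewrite eqpsi ?map_f.
Qed.

Lemma linear_lcomb X (Y : lmodType R) (f : {linear X -> Y}) (psi : K -> X) s :
  f (lcomb psi s) = lcomb (f \o psi) s.
Proof.
by rewrite /lcomb linear_sum; apply: eq_bigr => p _; rewrite linearZ.
Qed.

Lemma lcombB X (psi psi' : K -> X) s :
  lcomb (fun k => psi k - psi' k) s = lcomb psi s - lcomb psi' s.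
Proof. by rewrite /lcomb -sumrB; apply: eq_bigr => p _; rewrite scalerBr. Qed.

Definition indic (k k' : K) : R^o := (k' == k)%:R.

Definition coef s (k : K) : R := lcomb (indic k) s.

Lemma lcomb_coef X (psi : K -> X) s (V : seq K) :
  uniq V -> {subset [seq p.2 | p <- s] <= V} ->
  lcomb psi s = \sum_(k <- V) coef s k *: psi k.
Proof.
move=> uV sV; under eq_bigr => k _ do rewrite /coef /lcomb scaler_suml.
rewrite exchange_big /= /lcomb big_seq [RHS]big_seq.
apply: eq_bigr => p ps; rewrite (bigD1_seq p.2) ?sV ?map_f //=.
rewrite /indic eqxx -[1%:R]/(1 : R) [_ *: (_ : R^o)]mulr1.
rewrite big1 ?addr0 // => k kp.
by rewrite eq_sym (negPf kp) mulr0n scaler0 scale0r.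
Qed.

Lemma lcomb_coef_eq X (psi : K -> X) s s' :
  coef s =1 coef s' -> lcomb psi s = lcomb psi s'.
Proof.
move=> eqs; pose V := undup ([seq p.2 | p <- s] ++ [seq p.2 | p <- s']).
rewrite !(@lcomb_coef _ _ _ V) ?undup_uniq //.
- by apply: eq_bigr => k _; rewrite eqs.
- by move=> k; rewrite mem_undup mem_cat orbC => ->.
- by move=> k; rewrite mem_undup mem_cat => ->.
Qed.

(** The module consists of the coefficient functions of lists, and [c] picks a list for each of
    them. The choice is arbitrary, yet [lcomb psi (c x)] is linear in [x] because [lcomb psi] sees
    only coefficients. *)
Lemma free_module_exists :
  exists (F : lmodType R) (b : K -> F) (c : F -> seq (R * K)),
    (forall x, lcomb b (c x) = x) /\
    forall X (psi : K -> X), linear (fun x => lcomb psi (c x)) /\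
      forall k, lcomb psi (c (b k)) = psi k.
Proof.
have coefD a s1 s2 : coef (scale_lcomb a s1 ++ s2) =
    a *: (coef s1 : K -> R^o) + (coef s2 : K -> R^o).
  by apply/funext => k; rewrite /coef lcomb_cat lcomb_scale.
have [||F [j [ij jE]]] := @submodule_exists R (K -> R^o)
  (fun f => exists s, coef s = f).
- by exists [::]; apply/funext => k; rewrite /coef /lcomb big_nil.
- by move=> a _ _ [s1 <-] [s2 <-]; exists (scale_lcomb a s1 ++ s2).
have bP k : exists x, j x = coef [:: (1, k)] by apply/jE; exists [:: (1, k)].
have [b bE] := choice bP.
have cP x : exists s, coef s = j x by apply/jE; exists x.
have [c cE] := choice cP.
exists F, b, c; split=> [x | X psi].
  apply: ij; rewrite linear_lcomb -cE; apply/funext => k.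
  transitivity (lcomb (fun y => j (b y) k) (c x)).
    by rewrite /lcomb fct_sumE.
  rewrite /coef; apply: eq_lcomb => y _.
  by rewrite bE /coef /lcomb big_seq1 scale1r.
split=> [a x y | k].
  rewrite -lcomb_scale -lcomb_cat; apply: lcomb_coef_eq => k.
  by rewrite cE coefD !cE linearP.
rewrite (@lcomb_coef_eq _ _ _ [:: (1, k)]); last by move=> y; rewrite cE bE.
by rewrite /lcomb big_seq1 scale1r.
Qed.

End LinearCombinations.

Section Projective.
Variable R : pzRingType.
Implicit Types M P Q U V : lmodType R.

Lemma projective_cover M :
  exists (Q : lmodType R) (p : {linear Q -> M}), projective Q /\ surj p.
Proof.
have [F [b [c [cK cP]]]] := @free_module_exists R M.
exists F, (mklin (cP M id).1); split=> [U V p f sp | m]; last first.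
  by exists (b m); exact: (cP M id).2.
have [s sE] := choice sp.
exists (mklin (cP U (s \o f \o b)).1) => x /=.
by rewrite linear_lcomb -{2}(cK x) linear_lcomb; apply: eq_lcomb => k _ /=.
Qed.

Lemma projective_sum P1 P2 P (a1 : {linear P -> P1}) (b1 : {linear P1 -> P})
    (a2 : {linear P -> P2}) (b2 : {linear P2 -> P}) :
  projective P1 -> projective P2 ->
  (forall x, b1 (a1 x) + b2 (a2 x) = x) -> projective P.
Proof.
move=> P1p P2p id12 U V p f sp.
have [h1 h1E] := P1p U V p (f \o b1) sp.
have [h2 h2E] := P2p U V p (f \o b2) sp.
exists ((h1 \o a1) \+ (h2 \o a2)) => x /=.
by rewrite linearD h1E h2E /= -linearD id12.
Qed.

Lemma projective_retract Q P (a : {linear P -> Q}) (b : {linear Q -> P}) :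
  projective Q -> (forall x, b (a x) = x) -> projective P.
Proof.
move=> Qp ba; apply: (@projective_sum Q Q P a b a \0) => // x.
by rewrite ba addr0.
Qed.

(* The dual basis is indexed by the elements of [P] themselves, so that
   [psi |-> lcomb psi \o c] projects the functions on [P] onto the linear
   ones. *)
Lemma dual_basis P : projective P ->
  exists c : P -> seq (R * P), forall (X : lmodType R) (psi : P -> X),
    linear (fun x => lcomb psi (c x)) /\
    (linear psi -> forall x, lcomb psi (c x) = psi x).
Proof.
move=> Pp; have [F [b [c [cK cP]]]] := @free_module_exists R P.
have [|i iE] := Pp F P (mklin (cP P id).1) idfun.
  by move=> m; exists (b m); exact: (cP P id).2.
exists (c \o i) => X psi; split=> [a x y /= | Lpsi x /=].
  by rewrite linearP (cP X psi).1.
have -> : psi x = mklin Lpsi (idfun x) by [].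
by rewrite -iE /= -[RHS]/(mklin Lpsi _) linear_lcomb.
Qed.

End Projective.

(** * The character group Q/Z *)

Definition zsubgroup (V : zmodType) (H : V -> Prop) : Prop :=
  H 0 /\ forall x y, H x -> H y -> H (x - y).

Definition rat_integral : {pred rat} := fun x => x \is a Num.int.

Fact rat_integral_zmod_closed : zmod_closed rat_integral.
Proof. by split=> [|x y]; [exact: rpred0 | exact: rpredB]. Qed.

HB.instance Definition _ :=
  GRing.isZmodClosed.Build rat rat_integral rat_integral_zmod_closed.

Section Characters.
Implicit Types V D : zmodType.

Lemma zsubgroup_mulz V (H : V -> Prop) x (k : int) :
  zsubgroup H -> H x -> H (x *~ k).
Proof.
move=> [H0 HB] Hx.
have HN y : H y -> H (- y) by move=> Hy; rewrite -sub0r; exact: HB.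
have Hn n : H (x *+ n).
  elim: n => [//|n IHn]; rewrite mulrSr -[X in _ + X]opprK.
  by apply: HB => //; exact: HN.
by case: k => n; [exact: Hn | apply: HN; exact: Hn].
Qed.

(** The integers [k] with [v *~ k] in [H] form an ideal, generated by its least positive element, or
    by 0 if there is none. *)
Lemma zsubgroup_order V (H : V -> Prop) v : zsubgroup H ->
  exists n : nat, forall k : int, H (v *~ k) <-> (n%:Z %| k)%Z.
Proof.
move=> HH; have [H0 HB] := HH.
have [ex|nex] := pselect (exists n, [&& (0 < n)%N & `[< H (v *+ n) >]]).
  have [n /andP[n0 /asboolP Hn] nmin] := ex_minnP ex.
  exists n => k; split; last first.
    by move=> /dvdzP[q ->]; rewrite mulrC mulrzA; exact: zsubgroup_mulz.
  move=> Hk; have n0' : n%:Z != 0 by rewrite -lt0n.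
  have Hr : H (v *~ (k %% n)%Z).
    rewrite /modz mulrzBr; apply: HB => //.
    by rewrite mulrC mulrzA; exact: zsubgroup_mulz.
  have := modz_ge0 k n0'; have := ltz_mod k n0'.
  move: Hr; case E: (k %% n)%Z => [r|//] Hr rn _.
  apply/dvdz_mod0P; rewrite E; case: r Hr rn {E} => [//|r] Hr rn.
  have := nmin r.+1; rewrite ltn0Sn /= leqNgt -ltz_nat rn.
  by case: asboolP => // _ /(_ isT).
exists 0%N => k; rewrite dvd0z; split=> [Hk | /eqP ->]; last by rewrite mulr0z.
apply/negP => /negP k0; apply: nex; exists `|k|%N.
rewrite absz_gt0 k0; apply/asboolP; case: k Hk {k0} => n //= Hn.
by rewrite -[_ *+ _]opprK -sub0r; exact: HB.
Qed.

(** The group is Q/Z. For n > 1 the class of 1/n is nonzero and killed by n; for n = 0 the class of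
    1/2 serves. *)
Lemma divisible_torsion_exists : exists D : zmodType,
  (forall n (d : D), (0 < n)%N -> exists c, c *+ n = d) /\
  (forall n, n != 1%N -> exists2 c : D, c != 0 & c *+ n = 0).
Proof.
pose D := Quotient.quot rat_integral.
have pi0 (x : rat) : (\pi_D x == 0) = (x \is a Num.int).
  by rewrite -[LHS]/(_ == _) -[0 in LHS](raddf0 \pi_D) -Quotient.idealrBE subr0.
exists D; split=> [n d n0 | n n1].
  exists (\pi_D (repr d / n%:R)); rewrite -raddfMn -(mulr_natr (_ / _)) divfK.
    exact: reprK.
  by rewrite pnatr_eq0 -lt0n.
have [->|n0] := eqVneq n 0%N.
  by exists (\pi_D (1 / 2)); rewrite ?mulr0n // pi0.
exists (\pi_D (n%:R^-1)).
  rewrite pi0; apply/negP => /intrP[m mE].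
  have : n%:Z * m = 1.
    by apply: (@intr_inj rat); rewrite intrM -mE divff // pnatr_eq0.
  move=> /(congr1 absz); rewrite abszM => /eqP.
  by rewrite muln_eq1 (negPf n1).
apply/eqP; rewrite -raddfMn pi0 -(mulr_natr (_^-1)) mulVf ?rpred1 //.
by rewrite pnatr_eq0.
Qed.

(** The graph of an additive map on a subgroup of [V]: for a subgroup of the product, being
    single-valued at 0 is enough. *)
Definition functional_graph V D (G : V * D -> Prop) : Prop :=
  zsubgroup G /\ forall d, G (0, d) -> d = 0.

Lemma pair_mulrz V D (x : V) (d : D) (k : int) :
  (x, d) *~ k = (x *~ k, d *~ k).
Proof.
have pairMn m : (x, d) *+ m = (x *+ m, d *+ m).
  by elim: m => [//|m IHm]; rewrite !mulrS IHm.
by case: k => m; rewrite ?NegzE ?mulrNz -!pmulrn pairMn.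
Qed.

Lemma pair_subr V D (x y : V) (d e : D) : (x, d) - (y, e) = (x - y, d - e).
Proof. by []. Qed.

(** The multiples of [v] in the domain are those of some [v *~ n], so it is enough to divide the
    value there by [n]. For [n = 0] that value is 0 and any [c] works. *)
Lemma graph_step V D (G : V * D -> Prop) (v : V) :
  (forall n (d : D), (0 < n)%N -> exists c, c *+ n = d) ->
  functional_graph G -> exists c : D, forall k d, G (v *~ k, d) -> d = c *~ k.
Proof.
move=> divD [Gsub Gfun]; have [G0 GB] := Gsub.
have Hsub : zsubgroup (fun x => exists d, G (x, d)).
  split=> [|x y [d Gx] [e Gy]]; first by exists 0.
  by exists (d - e); exact: (GB _ _ Gx Gy).
have [n nP] := zsubgroup_order v Hsub.
have [c cP] : exists c : D, forall d, G (v *~ n, d) -> d = c *+ n.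
  have [d Gd] : exists d, G (v *~ n, d) by apply/nP; exact: dvdzz.
  have [n0|n0] := posnP n.
    by exists 0 => e; rewrite n0 mulr0z => /Gfun ->.
  have [c cn] := divD n d n0; exists c => e Ge; apply/eqP.
  rewrite cn -subr_eq0; apply/eqP/Gfun.
  by have := GB _ _ Ge Gd; rewrite pair_subr subrr.
exists c => k d Gk.
have /nP/dvdzP[q kE] : exists e, G (v *~ k, e) by exists d.
have [e Ge] : exists e, G (v *~ n, e) by apply/nP; exact: dvdzz.
apply/eqP; rewrite -subr_eq0; apply/eqP/Gfun.
have := GB _ _ Gk (zsubgroup_mulz q Gsub Ge).
by rewrite pair_mulrz pair_subr (cP e Ge) pmulrn -!mulrzA mulrC -kE subrr.
Qed.

Lemma graph_extend V D (G : V * D -> Prop) :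
  (forall n (d : D), (0 < n)%N -> exists c, c *+ n = d) ->
  functional_graph G ->
  exists h : V -> D, zmod_morphism h /\ forall x d, G (x, d) -> h x = d.
Proof.
(* The union with [G] makes the property hold for the empty chain too. *)
move=> divD Gf; pose P (A : set (V * D)) := functional_graph (G `|` A)%classic.
have [|A [[Asub Afun] Amax]] := @Zorn_bigcup _ P.
  move=> F FP Ftot.
  have common p q : (G `|` \bigcup_(X in F) X)%classic p ->
      (G `|` \bigcup_(X in F) X)%classic q ->
      exists B : set (V * D), [/\ functional_graph B, B p, B q &
        (B `<=` G `|` \bigcup_(X in F) X)%classic].
    have inF (X : set (V * D)) : F X ->
        (G `|` X `<=` G `|` \bigcup_(X in F) X)%classic.
      by move=> FX x [Gx | Xx]; [left | right; exists X].
    move=> [Gp | [X FX Xp]] [Gq | [Y FY Yq]].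
    - by exists G; split=> //; exact: subsetUl.
    - by exists (G `|` Y)%classic; split; [exact: FP|left|right|exact: inF].
    - by exists (G `|` X)%classic; split; [exact: FP|right|left|exact: inF].
    - have [XY | YX] := Ftot _ _ FX FY.
        exists (G `|` Y)%classic; split; [exact: FP| |by right|exact: inF].
        by right; exact: XY.
      exists (G `|` X)%classic; split; [exact: FP|by right| |exact: inF].
      by right; exact: YX.
  have G0 : G 0 by case: Gf => -[].
  split; [split|]; first by left.
  - move=> x y xG yG; have [B [[[_ BB] _] Bx By sB]] := common _ _ xG yG.
    by apply: sB; exact: BB.
  - by move=> d dG; have [B [[_ Bf] Bd _ _]] := common _ _ dG dG; exact: Bf.
pose B := (G `|` A)%classic.
have total v : exists d, B (v, d).
  apply: contrapT => nv.
  have [c cP] := graph_step v divD (conj Asub Afun).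
  (* The sum of [B] and the multiples of [(v, c)], again a functional graph by the choice of [c]. *)
  pose B' : set (V * D) := fun p => exists q k, B q /\ p = q + (v, c) *~ k.
  have BB' : (B `<=` B')%classic.
    by move=> p Bp; exists p, 0; rewrite mulr0z addr0.
  have B'vc : B' (v, c).
    by exists 0, 1; rewrite add0r mulr1z; split=> //; case: Asub.
  apply: (Amax B').
    split=> [|AB']; first by move=> p Ap; apply: BB'; right.
    by apply: nv; exists c; right; exact: AB'.
  rewrite /P; have -> : (G `|` B')%classic = B'.
    by rewrite eqEsubset; split=> [x [Gx | //]|]; [apply: BB'; left | right].
  have [B0 Bsub] := Asub; split; first split; first exact: BB'.
    move=> _ _ [p [k [Bp ->]]] [q [l [Bq ->]]]; exists (p - q), (k - l).
    by split; [exact: Bsub | rewrite mulrzBr opprD addrACA].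
  move=> d [[x e] [k [Bxe]]].
  rewrite pair_mulrz; case=> x0 ->.
  have := Bsub _ _ B0 Bxe; rewrite sub0r => Bxe'.
  have : B (v *~ k, - e).
    have -> : v *~ k = - x by apply/eqP; rewrite -addr_eq0 addrC -x0.
    exact: Bxe'.
  by move=> /cP <-; rewrite subrr.
have [h hB] := choice total.
have hE x d : B (x, d) -> h x = d.
  move=> Bx; apply/eqP; rewrite -subr_eq0; apply/eqP/Afun.
  by have := Asub.2 _ _ (hB x) Bx; rewrite pair_subr subrr.
exists h; split=> [x y | x d Gx]; last by apply: hE; left.
by apply: hE; exact: (Asub.2 _ _ (hB x) (hB y)).
Qed.

Definition zinjective D : Prop :=
  forall (U V : zmodType) (i : U -> V) (f : U -> D),
  zmod_morphism i -> zmod_morphism f -> injective i ->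
  exists h : V -> D, zmod_morphism h /\ forall u, h (i u) = f u.

Definition zcogenerator D : Prop := forall (V : zmodType) (H : V -> Prop) v,
  zsubgroup H -> ~ H v ->
  exists chi : V -> D,
    [/\ zmod_morphism chi, forall x, H x -> chi x = 0 & chi v <> 0].

(** For Q/Z both properties come from extending a graph. To separate [v] from [H], the initial map
    kills [H] and sends [v] to a nonzero element killed by the order of [v] modulo [H]. *)
Lemma injective_cogenerator_exists :
  exists D : zmodType, zinjective D /\ zcogenerator D.
Proof.
have [D [divD torD]] := divisible_torsion_exists; exists D; split.
  move=> U V i f iB fB iI.
  have i0 : i 0 = 0 by rewrite -(subrr 0) iB subrr.
  have f0 : f 0 = 0 by rewrite -(subrr 0) fB subrr.
  have [|h [hB hE]] :=
    @graph_extend V D (fun p => exists u, p = (i u, f u)) divD.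
    split; [split|]; first by exists 0; rewrite i0 f0.
      by move=> _ _ [u ->] [u' ->]; exists (u - u'); rewrite iB fB.
    by move=> d [u []]; rewrite -i0 => /iI <- ->.
  by exists h; split=> // u; apply: hE; exists u.
move=> V H v Hsub nHv; have [H0 HB] := Hsub.
have [n nP] := zsubgroup_order v Hsub.
have [|c c0 cn] := torD n.
  by apply/eqP => n1; apply: nHv; rewrite -(mulr1z v); apply/nP; rewrite n1.
have cker k : H (v *~ k) -> c *~ k = 0.
  by move=> /nP/dvdzP[q ->]; rewrite mulrC mulrzA -pmulrn cn mul0rz.
pose G (p : V * D) := exists x k, H x /\ p = (x + v *~ k, c *~ k).
have [|h [hB hE]] := @graph_extend V D G divD.
  split; [split|].
  - by exists 0, 0; rewrite !mulr0z addr0.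
  - move=> _ _ [x [k [Hx ->]]] [y [l [Hy ->]]]; exists (x - y), (k - l).
    split; first exact: HB.
    by rewrite !mulrzBr pair_subr opprD addrACA.
  - move=> d [x [k [Hx [xk ->]]]]; apply: cker.
    have -> : v *~ k = 0 - x by rewrite xk addrC addKr.
    exact: HB.
exists h; split=> // [x Hx|].
  by apply: hE; exists x, 0; rewrite !mulr0z addr0.
by rewrite (hE v c); [exact/eqP | exists 0, 1; rewrite !mulr1z add0r].
Qed.

Lemma zinjective_fun D (J : Type) : zinjective D -> zinjective (J -> D).
Proof.
move=> Di U V i f iB fB iI.
have hP j : exists h : V -> D, zmod_morphism h /\ forall u, h (i u) = f u j.
  by apply: Di => // x y; rewrite fB.
have [h hE] := choice hP.
exists (fun v j => h j v); split=> [x y|u]; apply/funext => j.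
  by rewrite (hE j).1.
exact: (hE j).2.
Qed.

End Characters.

(** * Tensor products and flatness *)

Section TensorTheory.
Variables (R : pzRingType) (A : lmodType R^c) (B : lmodType R).

Lemma tens_lift (Z : zmodType) (beta : A -> B -> Z) :
  (forall a a' b, beta (a + a') b = beta a b + beta a' b) ->
  (forall a b b', beta a (b + b') = beta a b + beta a b') ->
  (forall (r : R) a b, beta ((r : R^c) *: a) b = beta a (r *: b)) ->
  exists h : {additive tensor A B -> Z}, forall a b, h (tens a b) = beta a b.
Proof.
move=> bDl bDr bZ.
pose g (u : tens_free A B) : Z :=
  fglift (fun p => beta p.1 p.2 : zmodule Z) u.
have gB : {morph g : u v / u - v} 
  by move=> u v; exact: (@lift_is_additive _ _ (zmodule Z)).
have gU a b : g <<(a, b)>> = beta a b by rewrite /g liftU scale1r.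
have g_span u : tens_span u -> g u = 0.
  elim=> [|_ []|v w _ gv _ gw].
  - by rewrite -(subrr (0 : tens_free A B)) gB subrr.
  - by move=> a a' b; rewrite !gB !gU bDl -addrA -opprD subrr.
  - by move=> a b b'; rewrite !gB !gU bDr -addrA -opprD subrr.
  - by move=> r a b; rewrite !gB !gU bZ subrr.
  - by rewrite gB gv gw subrr.
pose h (x : tensor A B) := g (repr (x : Quotient.quot (@tens_kernel R A B))).
have hpi u : h (tens_pi u) = g u.
  apply/eqP; rewrite -subr_eq0 /h -gB; apply/eqP/g_span/tens_pi_eq.
  exact: tens_piK.
have hB : zmod_morphism h.
  move=> x y; rewrite -(tens_piK x) -(tens_piK y) -tens_piB !hpi; exact: gB.
by exists (mkadd hB) => a b; rewrite /= /tens hpi gU.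
Qed.

Lemma tensBl (a a' : A) (b : B) : tens (a - a') b = tens a b - tens a' b.
Proof. by apply/eqP; rewrite eq_sym subr_eq -tensDl subrK. Qed.

Lemma tens0l (b : B) : tens (0 : A) b = 0.
Proof. by apply: (addIr (tens 0 b)); rewrite -tensDl !add0r. Qed.

Lemma tens0r (a : A) : tens a (0 : B) = 0.
Proof. by apply: (addIr (tens a 0)); rewrite -tensDr !add0r. Qed.

Lemma tens_suml I (r : seq I) (F : I -> A) (b : B) :
  tens (\sum_(i <- r) F i) b = \sum_(i <- r) tens (F i) b.
Proof.
by elim/big_rec2: _ => [|i y x _ <-]; [exact: tens0l | rewrite tensDl].
Qed.

Lemma tens_sumr I (r : seq I) (a : A) (F : I -> B) :
  tens a (\sum_(i <- r) F i) = \sum_(i <- r) tens a (F i).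
Proof.
by elim/big_rec2: _ => [|i y x _ <-]; [exact: tens0r | rewrite tensDr].
Qed.

Lemma tensorP (u : tensor A B) :
  exists s : seq (A * B), u = \sum_(p <- s) tens p.1 p.2.
Proof.
pose G (v : tensor A B) :=
  exists s : seq (A * B), v = \sum_(p <- s) tens p.1 p.2.
have Gsub : zsubgroup G.
  split; first by exists [::]; rewrite big_nil.
  move=> _ _ [s ->] [s' ->]; exists (s ++ [seq (- p.1, p.2) | p <- s']).
  rewrite big_cat big_map -sumrN; congr (_ + _); apply: eq_bigr => p _ /=.
  by rewrite -[- p.1]sub0r tensBl tens0l sub0r.
have Gsum I (r : seq I) (F : I -> tensor A B) :
    (forall i, G (F i)) -> G (\sum_(i <- r) F i).
  move=> GF; elim/big_rec: _ => [|i x _ Gx]; first exact: Gsub.1.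
  have -> : F i + x = F i - (0 - x) by rewrite sub0r opprK.
  by apply: Gsub.2 => //; apply: Gsub.2 => //; exact: Gsub.1.
pose pi := mkadd (@tens_piB R A B : zmod_morphism (@tens_pi R A B)).
rewrite -(tens_piK u) -[tens_pi _]/(pi _) -[repr _]freeg_sumE raddf_sum.
apply: Gsum => -[a b]; rewrite -[coeff _ _]intz -freegU_mulz raddfMz.
apply: zsubgroup_mulz => //; exists [:: (a, b)].
by rewrite big_seq1.
Qed.

End TensorTheory.

Section Flatness.
Variable R : pzRingType.
Implicit Types M P Q K X : lmodType R.

Lemma tens_map_comp (A A' A'' : lmodType R^c) (B B' B'' : lmodType R)
    (f : {linear A -> A'}) (f' : {linear A' -> A''})
    (g : {linear B -> B'}) (g' : {linear B' -> B''})
    (f'' : {linear A -> A''}) (g'' : {linear B -> B''}) :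
  (forall a, f'' a = f' (f a)) -> (forall b, g'' b = g' (g b)) ->
  forall u, tens_map f'' g'' u = tens_map f' g' (tens_map f g u).
Proof.
move=> fE gE u; have [s ->] := tensorP u; rewrite !raddf_sum.
by apply: eq_bigr => p _ /=; rewrite !tens_mapE fE gE.
Qed.

(** Each coordinate of a dual basis induces a map from [A] tensor [P] to [A], natural in [A], and
    every tensor is determined by these coordinates. If its image over [B] is zero, [i] kills its
    coordinates, so they vanish. *)
Lemma projective_flat P : projective P -> flat P.
Proof.
move=> /dual_basis[c cP] A B i ii.
pose coord y : {linear P -> R^o} := mklin (cP R^o (indic R y)).1.
have alpha (A' : lmodType R^c) y :
    exists h : {additive tensor A' P -> A'},
      forall a x, h (tens a x) = (coord y x : R^c) *: a.
  apply: tens_lift => [a a' x | a x x' | r a x].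
  - by rewrite scalerDr.
  - by rewrite linearD scalerDl.
  - by rewrite linearZ /= scalerA.
(* [Y] gathers the basis elements that occur in [u], and [h] gives the coordinates of [u]. *)
have expand (A' : lmodType R^c) (u : tensor A' P) : exists Y : seq P,
    forall h : P -> A', (forall y, exists g : {additive tensor A' P -> A'},
      (forall a x, g (tens a x) = (coord y x : R^c) *: a) /\ h y = g u) ->
    u = \sum_(y <- Y) tens (h y) y.
  have [s ->] := tensorP u.
  pose Y := undup (flatten [seq [seq q.2 | q <- c p.2] | p <- s]).
  exists Y => h hP.
  have hE y : h y = \sum_(p <- s) (coord y p.2 : R^c) *: p.1.
    have [g [gE ->]] := hP y; rewrite raddf_sum; apply: eq_bigr => p _.
    exact: gE.
  under [RHS]eq_bigr => y _ do rewrite hE tens_suml.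
  rewrite exchange_big /= big_seq [RHS]big_seq; apply: eq_bigr => p ps.
  under eq_bigr => y _ do rewrite tensZ.
  rewrite -tens_sumr; congr tens.
  rewrite -[LHS]((cP P id).2 _ p.2) //.
  rewrite (@lcomb_coef _ _ _ _ _ Y) ?undup_uniq // => y yp.
  by rewrite mem_undup; apply/flatten_mapP; exists p.
move=> u v uv; apply/eqP; rewrite -subr_eq0; apply/eqP.
have {uv} : tens_map i (idfun : {linear P -> P}) (u - v) = 0.
  by rewrite raddfB /= uv subrr.
move: (u - v) => w w0; have [Y YP] := expand A w.
have aw y : exists a : A, exists g : {additive tensor A P -> A},
    (forall a x, g (tens a x) = (coord y x : R^c) *: a) /\ a = g w.
  by have [g gE] := alpha A y; exists (g w), g.
have [h hP] := choice aw; rewrite (YP h hP); apply: big1 => y _.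
have [g [gE ->]] := hP y; have [g' g'E] := alpha B y.
suff -> : g w = 0 by rewrite tens0l.
apply: ii; rewrite raddf0 -(raddf0 g') -w0.
have [s ->] := tensorP w; rewrite !raddf_sum; apply: eq_bigr => p _ /=.
by rewrite gE tens_mapE g'E linearZ.
Qed.

Lemma flat_retract Q M (a : {linear M -> Q}) (b : {linear Q -> M}) :
  flat Q -> (forall x, b (a x) = x) -> flat M.
Proof.
move=> Qf ba A B i ii u v uv.
pose idA := idfun : {linear A -> A}; pose idB := idfun : {linear B -> B}.
have bau w : w = tens_map idA b (tens_map idA a w).
  rewrite -(tens_map_comp (f'' := idA) (g'' := idfun)) //.
  have [s ->] := tensorP w; rewrite raddf_sum.
  by apply: eq_bigr => p _ /=; rewrite tens_mapE.
have ai w : tens_map i (idfun : {linear Q -> Q}) (tens_map idA a w) =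
            tens_map idB a (tens_map i (idfun : {linear M -> M}) w).
  rewrite -(tens_map_comp (f'' := i) (g'' := a)) //.
  by rewrite -(tens_map_comp (f'' := i) (g'' := a)).
rewrite (bau u) (bau v); congr (tens_map _ _ _).
by apply: (Qf _ _ _ ii); rewrite !ai uv.
Qed.

End Flatness.

(** * The equational criterion for flatness *)

Section EquationalCriterion.
Variables (R : pzRingType) (X : lmodType R).
Hypothesis flatX : flat X.

(* [D] encodes a factorization of [psi] through a finite free module: each
   [q] in [D] is a pair of a coordinate function and a vector. *)
Definition factors_on (K : choiceType) (psi : K -> X) (V : seq K)
    (D : seq ((K -> R^o) * X)) : Prop :=
  {in V, forall k, psi k = \sum_(q <- D) (q.1 k : R) *: q.2}.

(** Otherwise a character [chi] vanishes on the subgroup [N] of functions with such a factorization,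
    but not at [psi]. It induces a map [h] on the tensor product with [X] of the right ideal
    generated by the [r k]. Flatness kills the tensor [xi] built from the relation, whereas [h xi]
    equals [chi psi]. *)
Lemma flat_relation (K : choiceType) (psi : K -> X) (V : seq K) (r : K -> R) :
  uniq V -> \sum_(k <- V) r k *: psi k = 0 ->
  exists D, factors_on psi V D /\
    {in D, forall q, \sum_(k <- V) r k * q.1 k = 0}.
Proof.
move=> uV rel; apply: contrapT => nN.
pose N (f : K -> X) := exists D, factors_on f V D /\
    {in D, forall q, \sum_(k <- V) r k * q.1 k = 0}.
have Nsub : zsubgroup N.
  split; first by exists [::]; split=> // k _; rewrite big_nil.
  move=> f g [D [fD rD]] [E [gE rE]].
  exists (D ++ [seq (- q.1, q.2) | q <- E]); split=> [k kV | q].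
    rewrite big_cat big_map -[(f - g) k]/(f k - g k) fD // gE // -sumrN.
    by congr (_ + _); apply: eq_bigr => q _; rewrite /= scaleNr.
  rewrite mem_cat => /orP[/rD //| /mapP[p /rE pE ->]] /=.
  under eq_bigr => k _ do rewrite -[(- p.1) k]/(- p.1 k) mulrN.
  by rewrite sumrN pE oppr0.
have [D [_ cogen]] := injective_cogenerator_exists.
have [chi [chiB chiN chi_psi]] := cogen _ _ _ Nsub nN.
have [||A [j [ij jP]]] := @submodule_exists R^c (R^c)^o
    (fun x => exists a : K -> R, x = \sum_(k <- V) r k * a k).
- by exists (fun=> 0); rewrite big1 // => k _; rewrite mulr0.
- move=> c _ _ [a ->] [b ->]; exists (fun k => a k * c + b k).
  under [RHS]eq_bigr => k _ do rewrite mulrDr mulrA.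
  by rewrite big_split /= -mulr_suml.
have sP a : exists s : K -> R, j a = \sum_(k <- V) r k * s k.
  by apply/jP; exists a.
have [s sE] := choice sP.
have chi_eq (f g : K -> X) : N (f - g) -> chi f = chi g.
  by move=> /chiN; rewrite chiB => /eqP; rewrite subr_eq0 => /eqP.
(* The coefficients [s a] are determined up to solutions of the relation, which [chi] ignores; hence
   [h] below is well defined. *)
have N1 (a : K -> R) x :
    \sum_(k <- V) r k * a k = 0 -> N (fun k => a k *: x).
  move=> ra; exists [:: (a : K -> R^o, x)].
  by split=> [k _ | q]; rewrite ?big_seq1 // inE => /eqP ->.
have chiD f g : chi (f + g) = chi f + chi g.
  have chi0 : chi 0 = 0 by rewrite -(subrr 0) chiB subrr.
  by rewrite -{1}[g]opprK chiB -[- g]sub0r chiB chi0 sub0r opprK.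
have [||| h hE] := @tens_lift R A X D (fun a x => chi (fun k => s a k *: x)).
- move=> a a' x; rewrite -chiD; apply: chi_eq.
  have := @N1 (fun k => s (a + a') k - (s a k + s a' k)) x.
  rewrite (_ : (fun k => _ *: x) = (fun k => s (a + a') k *: x) -
     ((fun k => s a k *: x) + (fun k => s a' k *: x))).
    apply; under eq_bigr => k _ do rewrite mulrBr mulrDr.
    by rewrite sumrB big_split /= -!sE linearD subrr.
  by apply/funext => k; rewrite scalerBl scalerDl.
- move=> a x x'; rewrite -chiD; congr chi; apply/funext => k.
  by rewrite scalerDr.
- move=> c a x; apply: chi_eq.
  have := @N1 (fun k => s ((c : R^c) *: a) k - s a k * c) x.
  rewrite (_ : (fun k => _ *: x) = (fun k => s ((c : R^c) *: a) k *: x) -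
     (fun k => s a k *: (c *: x))).
    apply; under eq_bigr => k _ do rewrite mulrBr mulrA.
    by rewrite sumrB -mulr_suml -!sE linearZ /= subrr.
  by apply/funext => k; rewrite scalerBl -scalerA.
have eP k : exists e, k \in V -> j e = r k.
  have [kV|] := boolP (k \in V); last by exists 0.
  suff /jP[e eE] : exists a : K -> R, r k = \sum_(k <- V) r k * a k by exists e.
  exists (fun k' => (k' == k)%:R); rewrite (bigD1_seq k) //= eqxx mulr1.
  by rewrite big1 ?addr0 // => k' /negPf ->; rewrite mulr0.
have [e eE] := choice eP.
(* In the ring tensor [X], this becomes 1 tensored with the given relation, hence zero. *)
pose xi := \sum_(k <- V) tens (e k) (psi k).
have xi0 : xi = 0.
  apply: (flatX ij); rewrite !raddf_sum raddf0 /=.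
  transitivity (tens (1 : (R^c)^o) (\sum_(k <- V) r k *: psi k)).
    rewrite tens_sumr big_seq [RHS]big_seq; apply: eq_bigr => k kV.
    rewrite tens_mapE -tensZ eE //; congr tens.
    by rewrite -[RHS]/(1 * r k) mul1r.
  by rewrite rel tens0r.
apply: chi_psi; rewrite -(raddf0 h) -xi0 raddf_sum.
under [RHS]eq_bigr => k _ do rewrite hE.
have chi_sum (F : K -> K -> X) :
    \sum_(k <- V) chi (F k) = chi (\sum_(k <- V) F k).
  have chi0 : chi 0 = 0 by rewrite -(subrr 0) chiB subrr.
  by elim/big_rec2: _ => [|k y z _ ->]; rewrite ?chi0 ?chiD.
rewrite chi_sum; apply: chi_eq.
(* For each [k] in [V], the coordinate function is the indicator of [k] minus [s (e k)], a solution
   since [e k] represents [r k]. *)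
exists [seq (fun k' => (k' == k)%:R - s (e k) k' : R^o, psi k) | k <- V].
split=> [k kV | _ /mapP[k kV ->] /=].
  rewrite big_map -[(psi - _) k]/(psi k - _) fct_sumE.
  under [RHS]eq_bigr => k' _ do rewrite /= scalerBl.
  rewrite sumrB; congr (_ - _); rewrite (bigD1_seq k) //= eqxx scale1r.
  by rewrite big1 ?addr0 // => k'; rewrite eq_sym => /negPf ->; rewrite scale0r.
under eq_bigr => k' _ do rewrite mulrBr.
rewrite sumrB -sE eE // (bigD1_seq k) //= eqxx mulr1.
rewrite big1 ?addr0 ?subrr // => k' /negPf ->; exact: mulr0.
Qed.

(** Induction on the relations: a factorization that respects [L] turns [l] into one relation among
    its vectors; [flat_relation] factors these vectors in turn, and the two factorizations are
    composed. *)
Lemma flat_factor (K : choiceType) (psi : K -> X) (V : seq K)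
    (L : seq (seq (R * K))) :
  uniq V -> {in L, forall l, {subset [seq p.2 | p <- l] <= V}} ->
  {in L, forall l, lcomb psi l = 0} ->
  exists D, factors_on psi V D /\
    {in L & D, forall l q, lcomb q.1 l = 0}.
Proof.
move=> uV; elim: L => [|l L IHL] LV L0.
  exists [seq (fun k' => (k' == k)%:R : R^o, psi k) | k <- V]; split=> // k kV.
  rewrite big_map (bigD1_seq k) //= eqxx scale1r.
  by rewrite big1 ?addr0 // => k'; rewrite eq_sym => /negPf ->; rewrite scale0r.
have [||D [psiD LD]] := IHL.
- by move=> l' Ll'; apply: LV; rewrite inE Ll' orbT.
- by move=> l' Ll'; apply: L0; rewrite inE Ll' orbT.
have lV : {subset [seq p.2 | p <- l] <= V} by apply: LV; rewrite inE eqxx.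
pose d0 : (K -> R^o) * X := (0, 0).
(* The vectors of [D] are indexed by position, since they may repeat. *)
have [|D' [xD' rD']] := @flat_relation _ (fun i => (nth d0 D i).2)
    (index_iota 0 (size D)) (fun i => lcomb (nth d0 D i).1 l) (iota_uniq _ _).
  transitivity (lcomb psi l); last by apply: L0; rewrite inE eqxx.
  rewrite -(big_nth d0 xpredT (fun q => (lcomb q.1 l : R) *: q.2)).
  under eq_bigr => q _ do rewrite /lcomb scaler_suml.
    rewrite exchange_big /= /lcomb big_seq [RHS]big_seq; apply: eq_bigr => p pl.
  rewrite psiD ?lV ?map_f // scaler_sumr; apply: eq_bigr => q _.
  by rewrite scalerA.
exists [seq (fun k => \sum_(i <- index_iota 0 (size D))
                        ((nth d0 D i).1 k : R) * q.1 i : R^o, q.2) | q <- D'].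
split=> [k kV | l' _ Ll' /mapP[q qD' ->] /=].
  rewrite psiD // (big_nth d0) big_map.
  under [RHS]eq_bigr => q _ do rewrite /= scaler_suml.
  rewrite exchange_big /= big_seq [RHS]big_seq; apply: eq_bigr => i iD.
  by rewrite xD' // scaler_sumr; apply: eq_bigr => q _; rewrite scalerA.
rewrite /lcomb; under eq_bigr => p _ do rewrite scaler_sumr.
rewrite exchange_big /=.
under eq_bigr => i _.
  under eq_bigr => p _ do rewrite -[_ *: _]/(_ * (_ * _)) mulrA.
  rewrite -mulr_suml -/(lcomb (nth d0 D i).1 l').
over.
have {Ll'} [-> | Ll'] := predU1P Ll'; first exact: rD'.
rewrite big_seq big1 // => i; rewrite mem_index_iota => iD.
by rewrite LD ?mem_nth ?mul0r.
Qed.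

End EquationalCriterion.

(** It suffices that [j] stays injective after tensoring with [A], because [Q] is flat. A tensor [w]
    involves finitely many elements of [K], and the equational criterion for [M] gives a map [theta]
    from [Q] to [K] that inverts [j] on them. *)
Lemma flat_kernel (R : pzRingType) (K Q M : lmodType R)
    (j : {linear K -> Q}) (p : {linear Q -> M}) :
  projective Q -> flat M -> injective j -> surj p -> exact_at j p -> flat K.
Proof.
move=> Qp Mf ij sp ejp A B i ii u v uv.
suff jI : injective (tens_map (idfun : {linear A -> A}) j).
  apply: jI; apply: (projective_flat Qp ii).
  pose idB := idfun : {linear B -> B}.
  have ij_comm w : tens_map i (idfun : {linear Q -> Q})
      (tens_map (idfun : {linear A -> A}) j w) =
      tens_map idB j (tens_map i (idfun : {linear K -> K}) w).
    rewrite -(tens_map_comp (f'' := i) (g'' := j)) //.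
    by rewrite -(tens_map_comp (f'' := i) (g'' := j)).
  by rewrite !ij_comm uv.
move=> {B i ii uv} {}u {}v uv; apply/eqP; rewrite -subr_eq0; apply/eqP.
have {uv} : tens_map (idfun : {linear A -> A}) j (u - v) = 0.
  by rewrite raddfB /= uv subrr.
move: (u - v) => {u v} w w0.
have [s wE] := tensorP w.
have [c cP] := dual_basis Qp.
pose L := [seq c (j q.2) | q <- s].
pose V := undup (flatten [seq [seq q.2 | q <- l] | l <- L]).
have LV : {in L, forall l, {subset [seq p.2 | p <- l] <= V}}.
  by move=> l lL y yl; rewrite mem_undup; apply/flatten_mapP; exists l.
have [|D [pD LD]] := flat_factor Mf (psi := p) (undup_uniq _) LV.
  move=> _ /mapP[q qs ->]; rewrite (cP _ p).2; last exact: linearP.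
  by apply/ejp; exists q.2.
have [lft lftE] := choice sp.
(* A retraction of j on the finitely many elements occurring in w, obtained by
   subtracting from each v in V a lift of the factorization of p v. *)
have gP v : exists k, v \in V ->
    j k = v - \sum_(q <- D) (q.1 v : R) *: lft q.2.
  have [vV|] := boolP (v \in V); last by exists 0.
  suff /ejp[k kE] : p (v - \sum_(q <- D) (q.1 v : R) *: lft q.2) = 0.
    by exists k.
  rewrite linearB linear_sum pD //; apply/eqP; rewrite subr_eq0; apply/eqP.
  by apply: eq_bigr => q _; rewrite linearZ /= lftE.
have [g gE] := choice gP.
pose theta : {linear Q -> K} := mklin (cP K g).1.
have thetaK q : q \in s -> theta (j q.2) = q.2.
  move=> qs; apply: ij; rewrite linear_lcomb.
  have lL : c (j q.2) \in L by exact: map_f.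
  rewrite (eq_lcomb (psi' := fun v => v - \sum_(q <- D) (q.1 v : R) *: lft q.2));
    last by move=> v /(LV _ lL) vV; exact: gE.
  rewrite lcombB (cP _ id).2 // [X in _ - X](_ : _ = 0) ?subr0 //.
  rewrite /lcomb; under eq_bigr => x _ do rewrite scaler_sumr.
  rewrite exchange_big big_seq big1 //= => x xD.
  under eq_bigr => y _ do rewrite scalerA.
  by rewrite -scaler_suml -[X in X *: _]/(lcomb x.1 (c (j q.2))) LD ?scale0r.
rewrite -(raddf0 (tens_map (idfun : {linear A -> A}) theta)) -w0 wE !raddf_sum.
rewrite big_seq [RHS]big_seq; apply: eq_bigr => q qs /=.
by rewrite !tens_mapE thetaK.
Qed.

(** * Local extension of homomorphisms *)

Section Coinduced.
Variables (R : pzRingType) (D : zmodType).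

Definition additive_pred : {pred R -> D} := fun f => `[< zmod_morphism f >].

Fact additive_pred_closed : zmod_closed additive_pred.
Proof.
split=> [|f g /asboolP fB /asboolP gB]; apply/asboolP=> x y.
  by rewrite -[RHS]/(0 - 0) subrr.
by rewrite -[LHS]/(f _ - g _) fB gB !opprD !opprK addrACA.
Qed.

HB.instance Definition _ :=
  GRing.isZmodClosed.Build (R -> D) additive_pred additive_pred_closed.

(* The right module Hom_Z(R, D). *)
Record coinduced := Coinduced { ev : R -> D; _ : ev \in additive_pred }.

HB.instance Definition _ := [isSub for ev].
HB.instance Definition _ := [Choice of coinduced by <:].
HB.instance Definition _ := [SubChoice_isSubZmodule of coinduced by <:].

Lemma evB e : zmod_morphism (ev e).
Proof. exact/asboolP/(valP e). Qed.

Fact scale_coinduced_subproof (r : R^c) (e : coinduced) :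
  (fun x => ev e ((r : R) * x)) \in additive_pred.
Proof. by apply/asboolP => x y; rewrite mulrBr evB. Qed.

Definition scale_coinduced r e := Coinduced (scale_coinduced_subproof r e).

Fact scale_coinducedA a b e :
  scale_coinduced a (scale_coinduced b e) = scale_coinduced (a * b) e.
Proof. by apply: val_inj; apply/funext => x /=; rewrite mulrA. Qed.

Fact scale_coinduced1 : left_id 1 scale_coinduced.
Proof. by move=> e; apply: val_inj; apply/funext => x /=; rewrite mul1r. Qed.

Fact scale_coinducedDr : right_distributive scale_coinduced +%R.
Proof. by move=> r e e'; apply: val_inj. Qed.

Lemma evD e x y : ev e (x + y) = ev e x + ev e y.
Proof.
exact: (raddfD (mkadd (@evB e : zmod_morphism (U := R) (V := D) (ev e)))).
Qed.

Fact scale_coinducedDl e :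
  {morph scale_coinduced^~ e : a b / a + b}.
Proof.
by move=> a b; apply: val_inj; apply/funext => x /=; rewrite mulrDl evD.
Qed.

HB.instance Definition _ := GRing.Zmodule_isLmodule.Build R^c coinduced
  scale_coinducedA scale_coinduced1 scale_coinducedDr scale_coinducedDl.

(** By evaluation at 1, linear maps into Hom_Z(R, D) correspond to additive maps into [D], and the
    latter extend. *)
Lemma coinduced_injective : zinjective D -> injective_module coinduced.
Proof.
move=> Di U V i f ii.
have [|||h [hB hE]] := Di U V i (fun u => ev (f u) 1) => //.
- exact: raddfB.
- by move=> u v; rewrite raddfB.
have hD : {morph h : x y / x + y} by exact: (raddfD (mkadd hB)).
have gP v : (fun x : R => h ((x : R^c) *: v)) \in additive_pred.
  by apply/asboolP => x y; rewrite scalerBl hB.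
have gL : linear (fun v => Coinduced (gP v) : coinduced).
  move=> r u v; apply: val_inj; apply/funext => x /=.
  by rewrite scalerDr scalerA hD.
by exists (mklin gL) => u; apply: val_inj; apply/funext => x /=;
  rewrite -linearZ hE linearZ /= mulr1.
Qed.

End Coinduced.

Section LocalExtension.
Variable R : pzRingType.

Definition local_extension (X Q2 Q1 Q0 : lmodType R)
    (d1 : {linear Q2 -> Q1}) (d0 : {linear Q1 -> Q0}) : Prop :=
  forall T : seq Q1, exists T' : seq Q2, forall phi : {linear Q1 -> X},
    {in T', forall t, phi (d1 t) = 0} ->
    exists psi : {linear Q0 -> X}, {in T, forall t, psi (d0 t) = phi t}.

Variables (Q2 Q1 Q0 : lmodType R).
Variables (d1 : {linear Q2 -> Q1}) (d0 : {linear Q1 -> Q0}).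
Hypothesis projQ0 : projective Q0.
Hypothesis tens_exact : forall E : lmodType R^c, injective_module E ->
  exact_at (tens_map (idfun : {linear E -> E}) d1)
           (tens_map (idfun : {linear E -> E}) d0).

(* If the statement fails for T, each finite T' in Q2 has a witness phi T'
   which is separated from the extendable maps by a character. All these
   characters together form a cycle in E (x) Q1, E = Hom_Z(R, D^J), where J is
   the set of the T'. That cycle bounds, and the elements of Q2 involved in a
   bounding chain form a T' for which phi T' cannot exist. *)
Lemma ring_local_extension : local_extension R^o d1 d0.
Proof.
move=> T0; pose T := undup T0; have uT : uniq T by exact: undup_uniq.
apply: contrapT => /forallNP nT.
have {nT} phiP (T' : seq Q2) : exists phi : {linear Q1 -> R^o},
    {in T', forall t, phi (d1 t) = 0} /\
    ~ exists psi : {linear Q0 -> R^o}, {in T, forall t, psi (d0 t) = phi t}.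
  have /existsNP[phi /not_implyP[phi0 nphi]] := nT T'.
  exists phi; split=> // -[psi psiE]; apply: nphi; exists psi => t tT.
  by apply: psiE; rewrite mem_undup.
have [phi phiE] := choice phiP.
pose N (f : Q1 -> R^o) :=
  exists psi : {linear Q0 -> R^o}, {in T, forall t, psi (d0 t) = f t}.
have Nsub : zsubgroup N.
  split; first by exists \0.
  move=> f g [psi psiE] [psi' psi'E]; exists (psi \- psi') => t tT /=.
  by rewrite psiE ?psi'E.
have [D [Di Dcogen]] := injective_cogenerator_exists.
have chiP T' : exists chi : (Q1 -> R^o) -> D,
    [/\ zmod_morphism chi, forall f, N f -> chi f = 0 & chi (phi T') <> 0].
  by apply: Dcogen => //; exact: (phiE T').2.
have [chi chiE] := choice chiP.
have chiB T' : zmod_morphism (chi T') by case: (chiE T').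
pose chiA T' : {additive (Q1 -> R^o) -> D} := mkadd (chiB T').
pose E : lmodType R^c := coinduced R (seq Q2 -> D).
have Ei : injective_module E by exact/coinduced_injective/zinjective_fun.
(* [at_ t x] is the function with value [x] at [t] and 0 elsewhere; [e t] records the values of all
   the characters on it. *)
pose at_ (t : Q1) (x : R) : Q1 -> R^o := fun t' => if t' == t then x else 0.
have eP t : (fun (x : R) T' => chi T' (at_ t x))
    \in @additive_pred R (seq Q2 -> D).
  apply/asboolP => x y; apply/funext => T'; rewrite -[RHS]/(_ - _) -chiB.
  congr (chi T'); apply/funext => t'; rewrite /at_ -[RHS]/(_ - _).
  by case: eqP => _ //; rewrite subr0.
pose e t : E := Coinduced (eP t).
(* Functions that agree on [T] differ by an element of [N], so [chi T'] depends only on values on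
   [T]. *)
have chi_sum T' (f : Q1 -> R^o) : \sum_(t <- T) ev (e t) (f t) T' = chi T' f.
  rewrite -[RHS]/(chiA T' f).
  rewrite -[X in X = _]/(\sum_(t <- T) chiA T' (at_ t (f t))).
  rewrite -raddf_sum; apply/eqP; rewrite -subr_eq0 -raddfB; apply/eqP.
  have [_ chi0 _] := chiE T'; apply: chi0; exists \0 => t tT.
  rewrite -[RHS]/(_ - _) fct_sumE (bigD1_seq t) //= {1}/at_ eqxx.
  rewrite big1 ?addr0 ?subrr //.
  by move=> t' tt'; rewrite /at_ eq_sym (negPf tt').
pose xi : tensor E Q1 := \sum_(t <- T) tens (e t) t.
(* The coefficient of [y] in the image of [xi] is [chi T'] of the function
   [t |-> coord y (d0 t) * x], which is a linear map on [Q0] composed with [d0] and so lies in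
   [N]. *)
have xi_cycle : tens_map (idfun : {linear E -> E}) d0 xi = 0.
  have [c cP] := dual_basis projQ0.
  pose coord y : {linear Q0 -> R^o} := mklin (cP R^o (indic R y)).1.
  pose Y := undup (flatten [seq [seq q.2 | q <- c (d0 t)] | t <- T]).
  have dE t : t \in T -> d0 t = \sum_(y <- Y) (coord y (d0 t) : R) *: y.
    move=> tT; rewrite -[LHS]((cP Q0 id).2 _ (d0 t)) //.
    rewrite (@lcomb_coef _ _ _ _ _ Y) ?undup_uniq // => y yt.
    by rewrite mem_undup; apply/flatten_mapP; exists t.
  rewrite raddf_sum /= big_seq; under eq_bigr => t tT.
    rewrite tens_mapE dE // tens_sumr /=.
    under eq_bigr => y _ do rewrite -tensZ.
  over.
  rewrite -big_seq exchange_big /=; apply: big1 => y _.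
  rewrite -tens_suml [X in tens X _](_ : _ = 0) ?tens0l //.
  apply: val_inj; apply/funext => x; apply/funext => T'.
  rewrite raddf_sum /= !fct_sumE.
  rewrite [LHS](chi_sum T' (fun t => (coord y (d0 t) : R) * x)).
  have [_ chi0 _] := chiE T'; apply: chi0.
  have xL : linear (fun q => (coord y q : R) * x : R^o).
    by move=> a p q; rewrite linearP mulrDl -[a *: coord y p]/(a * _) -mulrA.
  by exists (mklin xL).
have /(tens_exact Ei)[eta etaE] := xi_cycle.
have [s sE] := tensorP eta; pose T' := [seq p.2 | p <- s].
have [_ _] := chiE T'; apply.
(* Evaluation at [phi T'] and index [T'] sends [xi] to [chi T' (phi T')], but the boundary of [eta]
   to 0. *)
have [||| h hE] := @tens_lift R E Q1 D (fun a x => ev a (phi T' x) T').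
- by [].
- by move=> a x x'; rewrite linearD evD.
- by move=> r a x; rewrite linearZ.
transitivity (h xi).
  by rewrite raddf_sum -chi_sum; apply: eq_bigr => t _; rewrite hE.
rewrite -etaE sE !raddf_sum big_seq big1 // => p ps /=.
rewrite tens_mapE hE (phiE T').1 ?map_f //.
by have := @evB _ _ p.1 0 0; rewrite !subrr => ->.
Qed.

Hypothesis projQ1 : projective Q1.

(** The [T'] found for the ring serves every flat [X]: [phi] factors, on a finite support, through a
    finite free module in such a way that its coordinates also vanish on [d1 T']. Each coordinate
    extends by the ring case. *)
Lemma flat_local_extension (X : lmodType R) : flat X -> local_extension X d1 d0.
Proof.
move=> Xf T; have [T' T'P] := ring_local_extension T; exists T' => phi phi0.
have [c cP] := dual_basis projQ1.
pose T1 := T ++ [seq d1 t | t <- T'].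
pose V := undup (flatten [seq [seq q.2 | q <- c t] | t <- T1]).
have cV t : t \in T1 -> {subset [seq q.2 | q <- c t] <= V}.
  by move=> tT y yt; rewrite mem_undup; apply/flatten_mapP; exists t.
have [||D [phiD D0]] := flat_factor Xf (psi := phi) (undup_uniq _ : uniq V)
    (L := [seq c (d1 t) | t <- T']).
- by move=> _ /mapP[t tT' ->]; apply: cV; rewrite mem_cat map_f ?orbT.
- move=> _ /mapP[t tT' ->]; rewrite (cP _ phi).2 ?phi0 //; exact: linearP.
have psiP (q : (Q1 -> R^o) * X) : exists psi : {linear Q0 -> R^o}, q \in D ->
    {in T, forall t, psi (d0 t) = lcomb q.1 (c t)}.
  have [qD|] := boolP (q \in D); last by exists \0.
  have [|psi psiE] := T'P (mklin (cP R^o q.1).1); last by exists psi.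
  by move=> t tT' /=; apply: D0 => //; exact: map_f.
have [psi psiE] := choice psiP.
have psiL : linear (fun y => \sum_(q <- D) (psi q y : R) *: q.2).
  move=> a x y; rewrite scaler_sumr -big_split; apply: eq_bigr => q _ /=.
  by rewrite linearP scalerDl scalerA.
exists (mklin psiL) => t tT /=.
rewrite -[RHS]((cP _ phi).2 (linearP phi)).
rewrite (eq_lcomb (psi' := fun k => \sum_(q <- D) (q.1 k : R) *: q.2));
  last first.
  by move=> k /cV kV; apply: phiD; apply: kV; rewrite mem_cat tT.
rewrite /lcomb; under [RHS]eq_bigr => p _ do rewrite scaler_sumr.
rewrite exchange_big /= big_seq [RHS]big_seq; apply: eq_bigr => q qD.
rewrite psiE // /lcomb scaler_suml; apply: eq_bigr => p _.
by rewrite scalerA.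
Qed.

End LocalExtension.

(** * Exactness of Hom from local extension *)

Lemma finite_stage (T : eqType) (S : T -> Prop) (C : nat -> seq T) m
    (U : seq T) :
  (forall n m, (n <= m)%N -> {subset C n <= C m}) ->
  {in U, forall u, S u \/ exists n, u \in C n} ->
  exists n, (m <= n)%N /\ {in U, forall u, S u \/ u \in C n}.
Proof.
move=> Cmono; elim: U => [|u U IHU] US; first by exists m.
have [|n [mn nP]] := IHU.
  by move=> v vU; apply: US; rewrite inE vU orbT.
have [Su | [m' um]] := US u (mem_head _ _).
  by exists n; split=> // v; rewrite inE => /predU1P[-> | /nP]; [left|].
exists (maxn m' n); split; first exact: leq_trans mn (leq_maxr _ _).
move=> v; rewrite inE => /predU1P[-> | /nP[Sv|vn]].
- by right; apply: Cmono um; rewrite leq_maxl.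
- by left.
- by right; apply: Cmono vn; rewrite leq_maxr.
Qed.

Section HomExact.
Variables (R : pzRingType) (Q : nat -> lmodType R).
Variables (d : forall k, {linear Q k -> Q k.+1}) (X : lmodType R).
Hypothesis dd : forall k x, d k.+1 (d k x) = 0.
Hypothesis locQ : forall k, local_extension X (d k) (d k.+1).

Variable c : forall k, Q k -> seq (R * Q k).
Hypothesis cP : forall k (Y : lmodType R) (psi : Q k -> Y),
  linear (fun x => lcomb psi (c x)) /\
  (linear psi -> forall x, lcomb psi (c x) = psi x).

Definition supp k (x : Q k) : seq (Q k) := [seq p.2 | p <- c x].

(** Allows a linear map to be prescribed by arbitrary values, its value at [x] depending only on
    those on [supp x]. *)
Definition lin k (psi : Q k -> X) : {linear Q k -> X} := mklin (cP psi).1.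

Lemma eq_lin k (psi psi' : Q k -> X) x :
  {in supp x, psi =1 psi'} -> lin psi x = lin psi' x.
Proof. exact: eq_lcomb. Qed.

Lemma lin_id k (psi : {linear Q k -> X}) x : lin psi x = psi x.
Proof. exact: (cP psi).2 (linearP psi) x. Qed.

Lemma lin0 k (psi : Q k -> X) x : {in supp x, forall y, psi y = 0} ->
  lin psi x = 0.
Proof. by move=> psi0; rewrite (eq_lin (psi' := \0)) // lin_id. Qed.

Definition extendable_from k (U : seq (Q k.+1)) (L : seq (Q k)) : Prop :=
  forall phi : {linear Q k.+1 -> X}, {in L, forall l, phi (d k l) = 0} ->
  exists psi : {linear Q k.+2 -> X}, {in U, forall u, psi (d k.+1 u) = phi u}.

(* Closed families play the role of subcomplexes on which local extension
   holds again, as well as on the quotient by them. *)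
Definition closed_family (S : forall k, Q k -> Prop) : Prop :=
  [/\ forall k x, S k x -> {in supp x, forall y, S k y},
      forall k x, S k x -> S k.+1 (d k x)
    & forall k (U : seq (Q k.+1)), {in U, forall u, S k.+1 u} ->
        exists L : seq (Q k), {in L, forall l, S k l} /\ extendable_from U L].

(** Local extension modulo [S]. The set [L] controls extension from [U], the part in [S] of the
    supports of the boundaries of [T]. A solution [psi0] for [T ++ L] is corrected by a map
    [chi \o d k.+2] that agrees with it on [U]. *)
Lemma relative_extension S k (T : seq (Q k.+1)) : closed_family S ->
  exists (W : seq (Q k.+1)) (T' : seq (Q k)), {in W, forall w, S k.+1 w} /\
    forall phi : {linear Q k.+1 -> X}, {in W, forall w, phi w = 0} ->
    {in T', forall t, phi (d k t) = 0} ->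
    exists psi : {linear Q k.+2 -> X}, (forall x, S k.+2 x -> psi x = 0) /\
      {in T, forall t, psi (d k.+1 t) = phi t}.
Proof.
move=> [Ssupp Sd Sext].
pose U := [seq u <- flatten [seq supp (d k.+1 t) | t <- T] | `[< S k.+2 u >]].
have [|L [SL UL]] := Sext k.+1 U.
  by move=> u; rewrite mem_filter => /andP[/asboolP].
have [T' T'P] := locQ (T ++ L).
exists L, T'; split=> // phi phiL phiT'.
have [psi0 psi0E] := T'P phi phiT'.
have [|chi chiE] := UL psi0.
  by move=> l lL; rewrite psi0E ?phiL // mem_cat lL orbT.
pose psi1 : {linear Q k.+2 -> X} := psi0 \- (chi \o d k.+2).
(* Cutting off on [S] keeps the values at [d k.+1 t], as [psi1] already vanishes on [U]. *)
pose psi := lin (fun y => if `[< S k.+2 y >] then 0 else psi1 y).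
exists psi; split=> [x Sx | t tT].
  by apply: lin0 => y yx; rewrite ifT //; apply/asboolP/(Ssupp _ x).
rewrite /psi (eq_lin (psi' := psi1)) => [|y yt].
  by rewrite lin_id /= dd raddf0 subr0 psi0E // mem_cat tT.
case: ifP => // Sy; rewrite /psi1 /= chiE ?subrr // mem_filter Sy.
by apply/flatten_mapP; exists t.
Qed.

Section Adjoin.
Variables (S : forall k, Q k -> Prop) (x0 : Q 1%N).
Arguments S _ _ : clear implicits.
Hypothesis closedS : closed_family S.

(** Starting from [x0], each step adds supports, boundaries and the finite sets given by
    [relative_extension]. A finite subset of the union lies in [S] and one stage, so local extension
    holds for it. *)
Lemma adjoin_family : exists C : nat -> forall k, seq (Q k),
  [/\ x0 \in C 0%N 1%N,
      forall n m k, (n <= m)%N -> {subset C n k <= C m k}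
    & closed_family (fun k x => S k x \/ exists n, x \in C n k)].
Proof.
have [Ssupp Sd Sext] := closedS.
pose rel k (T : seq (Q k.+1)) (T' : seq (Q k)) :=
  exists W : seq (Q k.+1), {in W, forall w, S k.+1 w} /\
    forall phi : {linear Q k.+1 -> X}, {in W, forall w, phi w = 0} ->
    {in T', forall t, phi (d k t) = 0} ->
    exists psi : {linear Q k.+2 -> X}, (forall x, S _ x -> psi x = 0) /\
      {in T, forall t, psi (d k.+1 t) = phi t}.
have relP k T : exists T', @rel k T T'.
  by have [W [T' WT']] := relative_extension T closedS; exists T', W.
pose r k (T : seq (Q k.+1)) : seq (Q k) := sval (cid (relP k T)).
have rP k T : rel k T (r k T) := svalP (cid (relP k T)).
pose step (C : forall k, seq (Q k)) k : seq (Q k) :=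
  C k ++ flatten [seq supp y | y <- C k] ++
  (match k with 0 => [::] | k'.+1 => [seq d k' y | y <- C k'] end) ++
  r k (C k.+1).
pose C0 k : seq (Q k) := match k with 1 => [:: x0] | _ => [::] end.
pose C n := iter n step C0.
have stepE n k x : x \in C n.+1 k = [|| x \in C n k,
    x \in flatten [seq supp y | y <- C n k],
    x \in (match k return seq (Q k) with
           | 0 => [::] | k'.+1 => [seq d k' y | y <- C n k'] end)
    | x \in r k (C n k.+1)].
  by rewrite /C iterS -/(C n) /step !mem_cat.
have Cmono n m k : (n <= m)%N -> {subset C n k <= C m k}.
  elim: m => [|m IHm]; first by rewrite leqn0 => /eqP ->.
  rewrite leq_eqVlt => /predU1P[-> // | nm] x xn.
  by rewrite stepE IHm.
exists C; split=> //; first by rewrite inE.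
split=> [k x [Sx|[n xn]] y yx | k x [Sx|[n xn]] | k U US].
- by left; exact: Ssupp yx.
- right; exists n.+1; rewrite stepE; apply/or4P/Or42.
  by apply/flatten_mapP; exists x.
- by left; exact: Sd.
- by right; exists n.+1; rewrite stepE; apply/or4P/Or43; exact: map_f.
have [n [_ nP]] := finite_stage 0 (fun n m => @Cmono n m _) US.
have [W [SW rW]] := rP k (C n k.+1).
(* [W] is included so that the defect [phi - psi0 d] vanishes on it, as the relative extension
   requires. *)
have [|L [SL LP]] := Sext k (W ++ [seq u <- U | `[< S k.+1 u >]]).
  move=> u; rewrite mem_cat mem_filter => /orP[/SW // | /andP[/asboolP //]].
exists (L ++ r k (C n k.+1)); split.
  move=> l; rewrite mem_cat => /orP[/SL Sl | lr]; first by left.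
  by right; exists n.+1; rewrite stepE lr !orbT.
move=> phi phiL.
have [|psi0 psi0E] := LP phi.
  by move=> l lL; apply: phiL; rewrite mem_cat lL.
have [||psi' [psi'S psi'E]] := rW (phi \- (psi0 \o d k.+1)).
- by move=> w wW /=; rewrite psi0E ?subrr // mem_cat wW.
- by move=> t tr /=; rewrite dd raddf0 subr0 phiL // mem_cat tr orbT.
exists (psi0 \+ psi') => u uU /=; have [Su | uC] := nP u uU.
  rewrite (psi'S _ (Sd _ _ Su)) addr0 psi0E // mem_cat mem_filter uU.
  by move/asboolP: Su => ->; rewrite orbT.
by rewrite psi'E //= addrC subrK.
Qed.

(** Maps [psi n] solve the equation on the finite sets [T n] and are stable on [C n 2]. To pass from
    [n] to [n.+1], a solution [psi1] on the larger set is changed by some [chi \o d 2], which leaves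
    the equation intact and restores the old values on [C n 2]. *)
Lemma adjoin_extension (phi : {linear Q 1%N -> X}) :
  (forall x, phi (d 0%N x) = 0) -> (forall x, S _ x -> phi x = 0) ->
  exists S' (psi : {linear Q 2%N -> X}),
    [/\ closed_family S' /\ S' 1%N x0, forall k x, S k x -> S' k x,
        forall x, S _ x -> psi x = 0
      & forall x, S' 1%N x -> psi (d 1%N x) = phi x].
Proof.
move=> phid phiS; have [C [C0 Cmono CS]] := adjoin_family.
exists (fun k x => S k x \/ exists n, x \in C n k).
have [Ssupp Sd _] := closedS; have [Csupp Cd _] := CS.
have ext0 (T : seq (Q 1%N)) : exists psi : {linear Q 2%N -> X},
    (forall x, S _ x -> psi x = 0) /\ {in T, forall t, psi (d 1%N t) = phi t}.
  have [W [T' [SW WP]]] := relative_extension T closedS.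
  by apply: WP => [w /SW /phiS | t _].
have extT (T : seq (Q 2%N)) : exists T' : seq (Q 1%N),
    forall psi : {linear Q 2%N -> X}, (forall x, S _ x -> psi x = 0) ->
    {in T', forall t, psi (d 1%N t) = 0} ->
    exists chi : {linear Q 3%N -> X}, (forall x, S _ x -> chi x = 0) /\
      {in T, forall t, chi (d 2%N t) = psi t}.
  have [W [T' [SW WP]]] := relative_extension T closedS.
  by exists T' => psi psiS psiT'; apply: WP => // w /SW /psiS.
have [r rP] := choice extT.
pose T := fix T n : seq (Q 1%N) := match n with
  | 0 => C 0%N 1%N ++ r (C 0%N 2%N)
  | n'.+1 => T n' ++ C n 1%N ++ r (C n 2%N) end.
have CT n : {subset C n 1%N <= T n}.
  by case: n => [|n] x xC; rewrite !mem_cat xC ?orbT.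
have rT n : {subset r (C n 2%N) <= T n}.
  by case: n => [|n] x xC; rewrite !mem_cat xC ?orbT.
pose good n (psi : {linear Q 2%N -> X}) := (forall x, S _ x -> psi x = 0) /\
  {in T n, forall t, psi (d 1%N t) = phi t}.
have stepP (p : nat * {linear Q 2%N -> X}) : exists psi' : {linear Q 2%N -> X},
    good p.1 p.2 -> good p.1.+1 psi' /\ {in C p.1 2%N, psi' =1 p.2}.
  case: p => n psi /=.
  have [[psiS psiT]|ng] := pselect (good n psi); last first.
    by exists psi => /ng.
  have [psi1 [psi1S psi1T]] := ext0 (T n.+1).
  have [||chi [chiS chiE]] := rP (C n 2%N) (psi1 \- psi).
  - by move=> x Sx /=; rewrite psi1S ?psiS ?subrr.
  - move=> t /rT tT /=; rewrite psi1T ?psiT ?subrr //.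
    by rewrite /= mem_cat tT.
  exists (psi1 \- (chi \o d 2%N)) => _; split; first split=> [x Sx | t tT] /=.
  - by rewrite psi1S // chiS ?subrr //; exact: Sd.
  - by rewrite dd raddf0 subr0 psi1T.
  - by move=> y yC /=; rewrite chiE //= opprB addrC subrK.
have [step stepE] := choice stepP.
have [psi0 psi0g] := ext0 (T 0%N).
pose psi := fix psi n :=
  match n with 0 => psi0 | n'.+1 => step (n', psi n') end.
have psig n : good n (psi n).
  by elim: n => [//|n IHn]; exact: (stepE (n, psi n) IHn).1.
have psi_stable n m y : (n <= m)%N -> y \in C n 2%N -> psi m y = psi n y.
  move=> nm yn; elim: m nm => [|m IHm]; first by rewrite leqn0 => /eqP ->.
  rewrite leq_eqVlt => /predU1P[-> // | nm]; rewrite -IHm //.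
  by apply: (stepE (m, psi m) (psig m)).2; exact: Cmono yn.
have idxP y : exists n, (exists m, y \in C m 2%N) -> y \in C n 2%N.
  have [[m ym]|ny] := pselect (exists m, y \in C m 2%N); first by exists m.
  by exists 0%N => /ny.
have [idx idxE] := choice idxP.
(* The limit need not be linear off the family; [lin] repairs this and keeps its values on the
   family. *)
pose psi_lim y := if `[< S 2%N y >] then 0 else psi (idx y) y.
have psi_limE n y : S 2%N y \/ y \in C n 2%N -> psi_lim y = psi n y.
  rewrite /psi_lim; case: asboolP => [Sy _ | nSy [//|yn]].
    by rewrite (psig n).1.
  have yi : y \in C (idx y) 2%N by apply: idxE; exists n.
  have [le_in | /ltnW le_ni] := leqP (idx y) n.
    by rewrite (psi_stable (idx y)).
  by rewrite (psi_stable n (idx y)).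
exists (lin psi_lim); split=> [|k x Sx | x Sx | t [St | [m tm]]].
- by split=> //; right; exists 0%N.
- by left.
- apply: lin0 => y yx; have Sy := Ssupp _ _ Sx _ yx.
  by rewrite (psi_limE 0%N) ?(psig _).1 //; left.
- rewrite phiS //; apply: lin0 => y yx.
  have Sy := Ssupp _ _ (Sd _ _ St) _ yx.
  by rewrite (psi_limE 0%N) ?(psig _).1 //; left.
have [||n [mn nP]] := @finite_stage _ (S 2%N) (fun n => C n 2%N) m
  (supp (d 1%N t)).
- by move=> n n' nn'; exact: Cmono.
- by apply: Csupp; apply: Cd; right; exists m.
rewrite (eq_lin (psi' := psi n)) ?lin_id.
  by apply: (psig n).2; apply: CT; exact: Cmono tm.
by move=> y /nP; exact: psi_limE.
Qed.

End Adjoin.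

(** Zorn's lemma for pairs of a closed family and a map solving the equation on it. The indices
    increase along the differential, so [phi] is a cocycle on [Q 1]. *)
Lemma hom_exact (phi : {linear Q 1%N -> X}) :
  (forall x, phi (d 0%N x) = 0) ->
  exists psi : {linear Q 2%N -> X}, forall x, psi (d 1%N x) = phi x.
Proof.
move=> phid.
pose partial := {p : (forall k, Q k -> Prop) * {linear Q 2%N -> X} |
  closed_family p.1 /\ forall x, p.1 1%N x -> p.2 (d 1%N x) = phi x}.
(* Only the values on the family count, so this is merely a preorder. *)
pose le (p q : partial) := `[< (forall k x, (sval p).1 k x -> (sval q).1 k x) /\
  forall y, (sval p).1 2 y -> (sval q).2 y = (sval p).2 y >].
have empty_closed : closed_family (fun _ _ => False).
  split=> // k [|u U] US; last by have := US u (mem_head _ _).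
  by exists [::]; split=> // f _; exists \0.
have p0P : closed_family (fun k (_ : Q k) => False) /\
  forall x : Q 1%N, False -> (\0 : {linear Q 2%N -> X}) (d 1%N x) = phi x by [].
pose p0 : partial := exist _ (fun _ _ => False, \0 : {linear Q 2%N -> X}) p0P.
have [||A Atot|p pmax] := @ZL_preorder partial p0 le.
- by move=> p; apply/asboolP.
- move=> q p s /asboolP[pq pqE] /asboolP[qs qsE]; apply/asboolP.
  by split=> [k x /pq/qs // | y py]; rewrite qsE ?pqE //; exact: pq.
- have [[a Aa] | nA] := pselect (exists a, A a); last first.
    by exists p0 => s As; case: nA; exists s.
  pose S k x := exists2 p, A p & (sval p).1 k x.
  have SU k (U : seq (Q k)) : {in U, forall u, S k u} ->
      exists2 p, A p & {in U, forall u, (sval p).1 k u}.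
    elim: U => [|u U IHU] US; first by exists a.
    have [|p Ap pU] := IHU.
      by move=> v vU; apply: US; rewrite inE vU orbT.
    have [q Aq qu] := US u (mem_head _ _).
    have [/asboolP[pq _] | /asboolP[qp _]] := Atot p q Ap Aq.
      by exists q => // v; rewrite inE => /predU1P[-> // | /pU /pq].
    by exists p => // v; rewrite inE => /predU1P[-> | /pU //]; exact: qp.
  have psiP y : exists v, forall p, A p -> (sval p).1 2 y -> (sval p).2 y = v.
    have [[q Aq qy] | nq] := pselect (S 2%N y); last first.
      by exists 0 => p Ap py; case: nq; exists p.
    exists ((sval q).2 y) => p Ap py.
    by have [/asboolP[_ ->] | /asboolP[_ ->]] := Atot p q Ap Aq.
  have [psi psiE] := choice psiP.
  have linE p y : A p -> (sval p).1 2 y -> lin psi y = (sval p).2 y.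
    move=> Ap py; rewrite (eq_lin (psi' := (sval p).2)) ?lin_id // => z zy.
    have [[psupp _ _] _] := svalP p.
    by rewrite (psiE z p) //; exact: psupp zy.
  have Sok : closed_family S /\ forall x, S 1%N x -> lin psi (d 1%N x) = phi x.
    split; first split.
    - move=> k x [p Ap px] y yx; exists p => //.
      by have [[psupp _ _] _] := svalP p; exact: psupp yx.
    - move=> k x [p Ap px]; exists p => //.
      by have [[_ pd _] _] := svalP p; exact: pd.
    - move=> k U /SU[p Ap pU]; have [[_ _ pext] _] := svalP p.
      have [L [pL UL]] := pext k U pU; exists L; split=> // l lL.
      by exists p => //; exact: pL.
    move=> x [p Ap px]; have [[_ pd _] pE] := svalP p.
    by rewrite (linE p) ?pE //; exact: pd.
  exists (exist _ (S, lin psi) Sok) => p Ap; apply/asboolP.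
  by split=> [k x px | y py] /=; [exists p | exact: linE].
have [Scl psiE] := svalP p; set S := (sval p).1 in Scl psiE.
set psi := (sval p).2 in psiE; exists psi => x; apply: (psiE).
(* Adjoining any [x] and solving for the remaining defect enlarges the solution; by maximality [x]
   was already in [S]. *)
have [||S' [psi' [[S'cl S'x] SS' psi'S psi'E]]] :=
  @adjoin_extension S x Scl (phi \- (psi \o d 1%N)).
- by move=> y /=; rewrite phid dd raddf0 subr0.
- by move=> y Sy /=; rewrite psiE ?subrr.
have newP : closed_family S' /\
    forall y, S' 1%N y -> (psi \+ psi') (d 1%N y) = phi y.
  by split=> // y S'y /=; rewrite psi'E //= addrC subrK.
have /pmax/asboolP[sub _] : le p
    (exist _ (S', (psi \+ psi') : {linear Q 2%N -> X}) newP).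
  by apply/asboolP; split=> //= y Sy; rewrite psi'S ?addr0.
exact: sub.
Qed.

End HomExact.

(** * Extensions of PGF-modules by flat modules *)

Section Complexes.
Variables (R : pzRingType) (P : chain_complex R).

Definition hom_acyclic (X : lmodType R) : Prop :=
  forall (i : int) (phi : {linear cterm P (i + 1) -> X}),
    (forall x, phi (cdiff P (i + 1) x) = 0) ->
    exists psi : {linear cterm P i -> X}, forall x, psi (cdiff P i x) = phi x.

Definition ccast a b (E : a = b) : {linear cterm P a -> cterm P b} :=
  match E with erefl => idfun end.

(** The degrees of the reindexed complex match only up to a provable equality, hence the
    transport. *)
Definition cdown a b (E : a = b + 1) : {linear cterm P a -> cterm P b} :=
  cdiff P b \o ccast E.

Lemma cdownK a b b' (E : a = b + 1) (E' : b = b' + 1) x :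
  cdown E' (cdown E x) = 0.
Proof. by subst b; subst a; exact: cdiffK. Qed.

Hypothesis projP : forall i, projective (cterm P i).

Lemma flat_hom_acyclic (X : lmodType R) :
  (forall E : lmodType R^c, injective_module E -> tens_acyclic E P) ->
  flat X -> hom_acyclic X.
Proof.
move=> tensP Xf i phi phi0.
have loc a b b' (E : a = b + 1) (E' : b = b' + 1) :
    local_extension X (cdown E) (cdown E').
  subst b; subst a.
  exact: (flat_local_extension (d1 := cdiff P (b' + 1)) (d0 := cdiff P b')
    (@projP _) (fun E Ei => tensP E Ei b') (@projP _) Xf).
(* The first three cases are separate so that they reduce to the degrees in
   the goal. *)
pose deg (k : nat) : int :=
  match k with
  | 0 => i + 1 + 1 | 1 => i + 1 | 2 => i | k'.+3 => i - k'.+1%:Z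
  end.
have degE k : deg k = deg k.+1 + 1.
  case: k => [|[|[|k]]] //=; first by rewrite subrK.
  by rewrite -[k.+2]addn1 PoszD opprD addrA subrK.
(* In these degrees both sides are convertible, so the transport is the identity. *)
have cast1 : degE 1%N = erefl by exact: eq_irrelevance.
have cast0 : degE 0%N = erefl by exact: eq_irrelevance.
have cP k := dual_basis (@projP (deg k)).
have [|||psi psiE] := @hom_exact R (fun k => cterm P (deg k))
  (fun k => cdown (degE k)) X _ _ (fun k => sval (cid (cP k)))
  (fun k => svalP (cid (cP k))) phi.
- by move=> k x; exact: cdownK.
- by move=> k; exact: loc.
- by move=> x; rewrite cast0; exact: phi0.
by exists psi => x; rewrite -psiE cast1.
Qed.

End Complexes.

(** * Resolutions and vanishing of Ext *)

Section Resolutions.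
Variable R : pzRingType.
Implicit Types (C : lmodType R -> Prop) (M L G K P X Y Z : lmodType R).

Lemma has_resolution0 C M : has_resolution C M 0 ->
  exists G (p : {linear G -> M}), [/\ C G, injective p & surj p].
Proof.
move=> [G [d [e [CG G0 se ede _]]]]; exists (G 0%N), e.
split=> //; first exact: CG.
move=> x y exy; apply/eqP; rewrite -subr_eq0; apply/eqP.
have /ede[u <-] : e (x - y) = 0 by rewrite linearB exy subrr.
by rewrite (G0 1%N _ u) ?raddf0.
Qed.

Lemma has_resolutionS C M n : has_resolution C M n.+1 ->
  exists L G (j : {linear L -> G}) (p : {linear G -> M}),
    [/\ C G, has_resolution C L n, injective j, surj p & exact_at j p].
Proof.
move=> [G [d [e [CG G0 se ede edd]]]].
have [L [j [ij ej]]] := kernel_exists e.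
have [w|e' e'E] := corestrict (f := d 0%N) ij.
  by apply/ej/ede; exists w.
exists L, (G 0%N), j, e; split=> //; first exact: CG.
exists (fun i => G i.+1), (fun i => d i.+1), e'; split=> //.
- by move=> i i_n; exact: CG.
- by move=> i n_i; exact: G0.
- move=> l; have /ede[u uE] : e (j l) = 0 by apply/ej; exists l.
  by exists u; apply: ij; rewrite e'E.
- move=> v; rewrite -(edd 0%N) -e'E; split=> [-> | /eqP]; first exact: raddf0.
  by rewrite -(raddf0 j) => /eqP/ij.
Qed.

Lemma has_resolution_cons C M L G n (j : {linear L -> G})
    (p : {linear G -> M}) :
  C G -> has_resolution C L n -> injective j -> surj p -> exact_at j p ->
  has_resolution C M n.+1.
Proof.
move=> CG [G' [d [e [CG' G'0 se ede edd]]]] ij sp ejp.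
pose H i := match i with 0 => G | i'.+1 => G' i' end.
pose dH i : {linear H i.+1 -> H i} :=
  match i return {linear H i.+1 -> H i} with 0 => j \o e | i'.+1 => d i' end.
exists H, dH, p; split=> //.
- by case=> [|i] //=; exact: CG'.
- by case=> [|i] //=; exact: G'0.
- move=> v; split=> [/ejp[l <-] | [u <-] /=]; last by apply/ejp; exists (e u).
  by have [u <-] := se l; exists u.
case=> [|i] //= v; rewrite -ede /=; split=> [/eqP | ->]; last exact: raddf0.
by rewrite -(raddf0 j) => /eqP/ij.
Qed.

Lemma zero_module_exists :
  exists Z : lmodType R, (forall z : Z, z = 0) /\ projective Z.
Proof.
exists 'rV[R]_0; have z0 (z : 'rV[R]_0) : z = 0 by apply/rowP => -[].
by split=> // U V p f _; exists \0 => z; rewrite (z0 z) !raddf0.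
Qed.

(** [M] in degree 0, padded with zero modules up to any length. *)
Lemma has_resolution_self C M n :
  (forall Z, projective Z -> C Z) -> C M -> has_resolution C M n.
Proof.
move=> Cproj CM; have [Z [Z0 Zp]] := zero_module_exists.
pose G i := match i with 0 => M | _ => Z end.
exists G, (fun i => \0), idfun; split=> [i _|i|x|x|i v].
- by case: i => [//|i]; exact: Cproj.
- by case: i => [//|i] _; exact: Z0.
- by exists x.
- by split=> [/= -> | [u <-]] //; exists 0.
- by split=> // _; exists 0; rewrite [RHS]Z0.
Qed.

(** Dimension shifting: [phi] lifts to [f] with values in [F], and [f d] is a cocycle with values in
    [L], hence some [chi d] by induction. Then [f - j chi] is a cocycle in the flat module [F]. *)
Lemma hom_acyclic_resolution (P : chain_complex R) X n :
  (forall i, projective (cterm P i)) ->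
  (forall F, flat F -> hom_acyclic P F) -> has_resolution (@flat R) X n ->
  hom_acyclic P X.
Proof.
move=> projP flatP; elim: n X => [|n IHn] X.
  move=> /has_resolution0[F [p [Ff pi ps]]]; apply: flatP.
  have [g [_ pK]] := bijective_inverse pi ps.
  exact: flat_retract Ff pK.
move=> /has_resolutionS[L [F [j [p [Ff Lres ij sp ejp]]]]] i phi phi0.
have [f fE] := projP _ _ _ p phi sp.
have [x|f' f'E] := corestrict (f := f \o cdiff P (i + 1)) ij.
  by apply/ejp; rewrite /= fE.
have [|chi chiE] := IHn L Lres (i + 1) f'.
  by move=> x; apply: ij; rewrite f'E /= cdiffK !raddf0.
have [|psi psiE] := flatP F Ff i (f \- (j \o chi)).
  by move=> x /=; rewrite chiE f'E subrr.
exists (p \o psi) => x /=; rewrite psiE linearB fE /=.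
have /ejp -> : exists u, j u = j (chi x) by exists (chi x).
exact: subr0.
Qed.

(* Ext^1(M, X) = 0 for a PGF-module M and X of finite flat dimension. *)
Lemma PGF_lift M X (Y Z : lmodType R) n (k : {linear X -> Y})
    (p : {linear Y -> Z}) (g : {linear M -> Z}) :
  PGF M -> has_resolution (@flat R) X n ->
  injective k -> surj p -> exact_at k p ->
  exists h : {linear M -> Y}, forall x, p (h x) = g x.
Proof.
move=> [P [projP acycP tensP [i [j [ij ej]]]]] Xres ik sp ekp.
have homP : hom_acyclic P X.
  apply: (hom_acyclic_resolution projP _ Xres) => F; exact: flat_hom_acyclic.
have [x|q qE] := corestrict (f := cdiff P (i + 1)) ij.
  by apply/ej/acycP; exists x.
have sq : surj q.
  move=> m; have /acycP[x xE] : cdiff P i (j m) = 0 by apply/ej; exists m.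
  by exists x; apply: ij; rewrite qE.
have qd x : q (cdiff P (i + 1 + 1) x) = 0.
  by apply: ij; rewrite qE cdiffK raddf0.
(* The lift [f] of [g q] is corrected by [k psi] so as to vanish on boundaries, that is on the
   kernel of [q]; it then descends to [M]. *)
have [f fE] := projP _ _ _ p (g \o q) sp.
have [x|f' f'E] := corestrict (f := f \o cdiff P (i + 1 + 1)) ik.
  by apply/ekp; rewrite /= fE /= qd raddf0.
have [|psi psiE] := homP (i + 1 + 1) f'.
  by move=> x; apply: ik; rewrite f'E /= cdiffK !raddf0.
have [|h hE] := quotient_factor (f := f \- (k \o psi)) sq.
  move=> x qx0; have /acycP[y <-] : cdiff P (i + 1) x = 0.
    by rewrite -qE qx0 raddf0.
  by rewrite /= psiE f'E subrr.
exists h => m; have [x <-] := sq m; rewrite hE linearB fE /=.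
have /ekp -> : exists u, k u = k (psi x) by exists (psi x).
exact: subr0.
Qed.

(** The complex has [M * M] in each degree and differential [(x, y) |-> (0, x)]. The contraction
    [(x, y) |-> (y, 0)] survives tensoring. *)
Lemma projective_PGF M : projective M -> PGF M.
Proof.
move=> Mp.
pose N : lmodType R := (M * M)%type.
have dL : linear (fun v : N => (0, v.1) : N).
  by move=> a x y; rewrite -[RHS]/(a *: 0 + 0, _) scaler0 addr0.
have sL : linear (fun v : N => (v.2, 0) : N).
  by move=> a x y; rewrite -[RHS]/(_, a *: 0 + 0) scaler0 addr0.
have inlL : linear (fun x : M => (x, 0) : N).
  by move=> a x y; rewrite -[RHS]/(_, a *: 0 + 0) scaler0 addr0.
have inrL : linear (fun x : M => (0, x) : N).
  by move=> a x y; rewrite -[RHS]/(a *: 0 + 0, _) scaler0 addr0.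
have fstL : linear (fun v : N => v.1) by [].
have sndL : linear (fun v : N => v.2) by [].
have Np : projective N.
  apply: (@projective_sum _ M M N (mklin fstL) (mklin inlL) (mklin sndL)
    (mklin inrL)) => // -[x y].
  by rewrite -[LHS]/(x + 0, 0 + y) addr0 add0r.
have dd (i : int) (x : N) : mklin dL (mklin dL x) = 0 by [].
exists (@ChainComplex R (fun=> N) (fun=> mklin dL) dd); split=> [//|i||].
- move=> [x y]; split=> [[/= ->] | [[u v] [<- _]] //].
  by exists (y, 0).
- move=> E _ i u /=.
  pose idE := idfun : {linear E -> E}.
  have comp0 w : tens_map idE (mklin dL) (tens_map idE (mklin dL) w) = 0.
    have [s ->] := tensorP w; rewrite !raddf_sum big1 // => p _ /=.
    by rewrite !tens_mapE tens0r.
  split=> [u0 | [w <-] //].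
  exists (tens_map idE (mklin sL) u).
  rewrite -[RHS]subr0 -(raddf0 (tens_map idE (mklin sL))) -u0.
  apply: (canRL (addrK _)).
  have [s ->] := tensorP u; rewrite !raddf_sum -big_split.
  apply: eq_bigr => -[e [x y]] _ /=; rewrite !tens_mapE /= -tensDr.
  by rewrite -[(0, y) + _]/(0 + x, y + 0) add0r addr0.
exists 0, (mklin inrL); split=> [x y []|] //.
by case=> x y; split=> [[/= ->] | [z [<- _]] //]; exists y.
Qed.

(** Two sequences ending in [M] split by [PGF_lift]: first the start of a flat resolution, so [M] is
    flat; then a projective presentation, whose kernel is now flat. *)
Lemma PGF_finite_fd_projective M n :
  PGF M -> has_resolution (@flat R) M n -> projective M.
Proof.
move=> GM; suff flat_proj : flat M -> projective M.
  case: n => [|n].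
    move=> /has_resolution0[F [p [Ff pi ps]]]; apply: flat_proj.
    by have [g [_ pK]] := bijective_inverse pi ps; exact: flat_retract Ff pK.
  move=> /has_resolutionS[L [F [j [p [Ff Lres ij sp ejp]]]]]; apply: flat_proj.
  have [h hK] := PGF_lift idfun GM Lres ij sp ejp.
  exact: flat_retract Ff hK.
move=> Mf; have [Q [q [Qp sq]]] := projective_cover M.
have [K [j [ij ejq]]] := kernel_exists q.
have Kf := flat_kernel Qp Mf ij sq ejq.
have Kres := has_resolution_self 0 (@projective_flat R) Kf.
have [h hK] := PGF_lift idfun GM Kres ij sq ejq.
exact: projective_retract Qp hK.
Qed.

(* Applied with [L = K] and [f = s = idfun]; the general form passes to
   syzygies. *)
Lemma flat_stable_retract_pd L K P n (f : {linear L -> K}) (s : {linear K -> L})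
    (a : {linear K -> P}) (b : {linear P -> K}) :
  has_resolution (@PGF R) L n -> flat K -> projective P ->
  (forall x, f (s x) + b (a x) = x) -> has_resolution (@projective R) K n.
Proof.
elim: n L K P f s a b => [|n IHn] L K P f s a b Lres Kf Pp fsba;
  have [Q [q [Qp sq]]] := projective_cover K;
  have [K' [k [ik ekq]]] := kernel_exists q;
  have K'f := flat_kernel Qp Kf ik sq ekq;
  have K'res := has_resolution_self 0 (@projective_flat R) K'f.
- apply: has_resolution_self => //.
  have [G [g [GG gi gs]]] := has_resolution0 Lres.
  have [g' [gK g'K]] := bijective_inverse gi gs.
  (* As [f] lifts along [q], the identity of [K] factors through the sum of [Q] and [P]. *)
  have [h hE] := PGF_lift (f \o g) GG K'res ik sq ekq.
  apply: (@projective_sum _ Q P K (h \o g' \o s) q a b) => // x /=.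
  by rewrite hE /= g'K.
have [L' [G [j [g [GG L'res ij sg ejg]]]]] := has_resolutionS Lres.
(* The lifts [F] and [S] of [f] and [s] induce maps [f'] and [s'] between the syzygies. *)
have [F FE] := PGF_lift (f \o g) GG K'res ik sq ekq.
have [S SE] := Qp _ _ g (s \o q) sg.
have qk x : q (k x) = 0 by apply/ekq; exists x.
have gj x : g (j x) = 0 by apply/ejg; exists x.
have [x|f' f'E] := corestrict (f := F \o j) ik.
  by apply/ekq; rewrite /= FE /= gj raddf0.
have [x|s' s'E] := corestrict (f := S \o k) ij.
  by apply/ejg; rewrite /= SE /= qk raddf0.
have [b' b'E] := Pp _ _ q b sq.
(* The homotopy: [q] kills this map, and on [K'] its last term vanishes, so [f' s' + t k] is the
   identity, with [Q] in place of [P]. *)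
have [x|t tE] := corestrict (f := (idfun \- (F \o S)) \- (b' \o a \o q)) ik.
  apply/ekq; rewrite /= !linearB FE b'E /= SE /= -[X in X - _ - _]fsba.
  by rewrite addrAC addrK subrr.
apply: (has_resolution_cons Qp _ ik sq ekq).
apply: (IHn L' K' Q f' s' k t) => // x; apply: ik.
by rewrite linearD f'E /= s'E tE /= qk !raddf0 addr0 addrC subrK.
Qed.

End Resolutions.

Theorem proposition2p5 (R : pzRingType) (M : lmodType R) :
  (flat M -> pd M = PGF_dim M) /\ (PGF M -> pd M = fd M).
Proof.
have mono (C C' : lmodType R -> Prop) n :
    (forall N, C N -> C' N) -> has_resolution C M n -> has_resolution C' M n.
  move=> CC' [G [d [e [CG G0 se ede edd]]]].
  by exists G, d, e; split=> // i /CG /CC'.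
split=> [Mf | GM]; rewrite /pd /PGF_dim /fd /resolution_dim.
  (* The dimensions agree because resolutions of each length [n] exist simultaneously. *)
  suff -> : has_resolution (@projective R) M = has_resolution (@PGF R) M by [].
  apply/funext => n; apply/propext; split; first exact/mono/projective_PGF.
  move=> Mres; have [Z [_ Zp]] := zero_module_exists R.
  apply: (@flat_stable_retract_pd _ M M Z n idfun idfun \0 \0) => // x.
  by rewrite /= addr0.
suff -> : has_resolution (@projective R) M = has_resolution (@flat R) M by [].
apply/funext => n; apply/propext; split; first exact/mono/projective_flat.
move=> Mres; apply: has_resolution_self => //.
exact: PGF_finite_fd_projective Mres.
Qed.
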